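(* Let $k\ge 2$, $m\ge 1$ be integers and let $\hat{\xi}(x_1,\dots,x_m)=\dfrac{km-1}{x_1+\dots+x_m}$. Then, as $\theta\to\infty$, $$\mathbb{E}\left[\left(\hat{\xi}(X_{(k),1},\ldots,X_{(k),m})-\theta\right)^2\right]=\frac{\theta^2}{km-2}+\mathrm{o}(\theta^2).$$
   Context: For a positive integer $\theta$ (the unknown number of distinct elements), let $U_1,\dots,U_\theta$ be independent random variables uniform on $[0,1]$ (the distinct hashed values). For $1\le i\le m$, let $Z_{(k),i}$ be the $k$-th smallest of the values $U_j$ lying in $[\frac{i-1}{m},\frac{i}{m})$, with $Z_{(k),i}=\frac{i}{m}$ if fewer than $k$ of the $U_j$ lie in this interval. Set $X_{(k),i}=Z_{(k),i}-\frac{i-1}{m}$. *)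

(* Defs.v *)
From mathcomp Require Import all_boot all_order all_algebra.
From mathcomp Require Import all_classical all_reals all_analysis.

Set Implicit Arguments.
Unset Strict Implicit.
Unset Printing Implicit Defensive.

Import Order.TTheory GRing.Theory Num.Theory.
Import numFieldNormedType.Exports.

Local Open Scope classical_set_scope.
Local Open Scope ring_scope.

Definition mutually_independent (R : realType) (d : measure_display)
    (T : measurableType d) (P : probability T R) (I : finType)
    (X : I -> {RV P >-> R}) : Prop :=
  forall (J : {set I}) (B : I -> set R),
    (forall j, j \in J -> measurable (B j)) ->
    P (\bigcap_(j in [set` J]) (X j @^-1` B j)) =
      (\prod_(j in J) P (X j @^-1` B j))%E.

Definition uniform01 (R : realType) (d : measure_display)
    (T : measurableType d) (P : probability T R) (X : {RV P >-> R}) : Prop :=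
  forall A : set R, measurable A ->
    distribution P X A = uniform_prob (@ltr01 R) A.

(* Intervals are indexed from 0: [i : 'I_m] stands for the (i+1)-st interval
   [i / m, (i + 1) / m). *)
Definition values_in (R : realType) (m : nat) (i : 'I_m) (n : nat)
    (u : 'I_n -> R) : seq R :=
  [seq u j | j <- enum 'I_n & i%:R / m%:R <= u j < i.+1%:R / m%:R].

(* The k-th smallest value (k >= 1, ties counted with multiplicity) sits at
   position k - 1 of the sorted list; [nth] returns its default, the right end
   of the interval, when there are fewer than k values. *)
Definition Zstat (R : realType) (k m : nat) (i : 'I_m) (n : nat)
    (u : 'I_n -> R) : R :=
  nth (i.+1%:R / m%:R) (sort <=%R (values_in i u)) k.-1.

Definition Xstat (R : realType) (k m : nat) (i : 'I_m) (n : nat)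
    (u : 'I_n -> R) : R :=
  Zstat k i u - i%:R / m%:R.

Definition xi_hat (R : realType) (k m : nat) (x : 'I_m -> R) : R :=
  ((k * m)%:R - 1) / \sum_(i < m) x i.

(* Main.v *)
From HB Require Import structures.
Require Import Defs.
From mathcomp Require Import all_boot all_order all_algebra.
From mathcomp Require Import perm action primitive_action alt.
From mathcomp Require Import all_classical all_reals all_analysis.
From mathcomp Require Import measurable_realfun.
From mathcomp Require Import zify ring lra.
Import Order.TTheory GRing.Theory Num.Theory.
Import numFieldNormedType.Exports.

(** Write n = k m and S for the sum of the X's, so that the
    estimator is (n - 1) / S.  The joint density of the X's at a point
    (x_1, ..., x_m) of [0, 1/m)^m is proportional to
    (x_1 ... x_m)^(k - 1) (1 - x_1 - ... - x_m)^(theta - n), and a Dirichlet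
    integral shows that, below 1/m, S has exactly the law of the n-th smallest of
    theta uniform variables, Beta(n, theta - n + 1).  If n > 2 and B is a variable
    with that beta law, then B^-1 and B^-2 have explicit means and
    E[((n - 1) / B - theta)^2] = (theta^2 - (n - 1) theta) / (n - 2)
    ([beta_sq_err]).  Above 1/m the squared error is O(theta^2), and the beta mass
    there, which is also the probability that S >= 1/m, is O(1 / theta) by Markov's
    inequality ([beta_tail_le]).  Both expectations therefore differ by
    O(theta) ([mse_close]).  For n = 2, that is k = 2 and m = 1, the density of
    S vanishes only like x at 0, so the expectation is infinite
    ([beta_sq_err_pinfty]), as is the leading term.

    The identity in law ([prob_sumX_le]) is proved by counting rather than with
    densities.  Cut each interval into L cells, and look at the cells one after the
    other: from the left end of the first interval until k values have been found,
    then from the left end of the second one, and so on, the last interval being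
    pursued beyond its k-th value.  The next cell depends only on what the previous
    ones contained, and the cells not yet opened are exchangeable, so the number of
    values found in the first T cells opened has the same law as the number of
    values in T cells fixed in advance ([card_history]): it is binomial.  If no two
    values share a cell, at least n values are found among the first T cells exactly
    when every interval has revealed its k-th value, that is when S is at most
    T / (m L), up to the width of the cells ([finished_found], [found_finished]).
    Letting L tend to infinity gives P(S <= t) = P(Bin(theta, t) >= n), and this
    binomial tail is the distribution function of the beta law, because its
    derivative in t telescopes ([beta_prob_ray]). *)

Set Implicit Arguments.
Unset Strict Implicit.
Unset Printing Implicit Defensive.

(** * Adaptive exploration of cells *)

Section Exploration.
Variables (I C : finType).
Implicit Types (next : seq {set I} -> C) (c : {ffun I -> C}) (h : seq {set I}).

(** A strategy [next] chooses the cell to open from the sets of labels found in the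
    cells opened so far; the history lists these sets. *)
Fixpoint history next c (T : nat) : seq {set I} :=
  if T is T'.+1 then
    let h := history next c T' in rcons h [set j | c j == next h]
  else [::].

Lemma historyS next c T : history next c T.+1 =
  rcons (history next c T) [set j | c j == next (history next c T)].
Proof. by []. Qed.

(** Freshness is asked along every sequence of answers, whether or not some
    configuration produces it. *)
Definition explores next (T : nat) : Prop :=
  forall h, size h = T -> uniq [seq next (take t h) | t <- iota 0 T].

Lemma size_history next c T : size (history next c T) = T.
Proof. by elim: T => //= T IH; rewrite size_rcons IH. Qed.

(** Once the answers are prescribed, so are the cells: a history is a condition on
    the content of [T] cells that do not depend on the configuration. *)
Lemma history_eq next c (T : nat) h : size h = T ->
  (history next c T == h) =
  all (fun t => [set j | c j == next (take t h)] == nth finset.set0 h t) (iota 0 T).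
Proof.
elim: T h => [|T IH] h; first by move/size0nil => ->.
case/lastP: h => // h s; rewrite size_rcons => -[hT].
rewrite -[in iota _ _]addn1 iotaD all_cat /= andbT add0n.
have -> : take T (rcons h s) = h by rewrite -cats1 take_size_cat.
rewrite nth_rcons hT ltnn eqxx eqseq_rcons IH //.
have -> : all (fun t => [set j | c j == next (take t (rcons h s))]
      == nth finset.set0 (rcons h s) t) (iota 0 T) = 
    all (fun t => [set j | c j == next (take t h)] == nth finset.set0 h t) (iota 0 T).
  apply: eq_in_all => t; rewrite mem_iota /= add0n => tT.
  by rewrite nth_rcons hT tT -cats1 takel_cat // hT ltnW.
case: (boolP (all _ _)) => //= H.
by rewrite -IH // in H; rewrite (eqP H).
Qed.

Lemma exists_perm_map (s t : seq C) : uniq s -> uniq t -> size s = size t ->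
  exists p : {perm C}, map p s = t.
Proof.
move=> us ut est.
have sC : (size s <= #|C|)%N by rewrite -(card_uniqP us) max_card.
have tr := ntransitive_weak sC (Sym_trans C).
have ds : in_tuple s \in (size s).-dtuple(finset.setT).
  by rewrite inE us; apply/fintype.subsetP => ? _; rewrite inE.
have et : size t == size s by rewrite est.
have dt : Tuple et \in (size s).-dtuple(finset.setT).
  by rewrite inE ut; apply/fintype.subsetP => ? _; rewrite inE.
have [p _ /(congr1 val) /= e] := atransP2 tr ds dt.
by exists p; rewrite e.
Qed.

(** The two strategies, fed with the answers [h], open two lists of distinct cells;
    relabelling the cells by a permutation that sends one list to the other
    turns the configurations with history [h] for one into those for the other. *)
Lemma card_history_fiber next next' T h : size h = T ->
  explores next T -> explores next' T ->
  #|[set c | history next c T == h]| = #|[set c | history next' c T == h]|.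
Proof.
move=> hT /(_ h hT) ex /(_ h hT) ex'.
have [p ep] := exists_perm_map ex ex' (etrans (size_map _ _) (esym (size_map _ _))).
pose f c : {ffun I -> C} := [ffun j => p (c j)].
have injf : injective f.
  move=> c1 c2 /ffunP e; apply/ffunP => j.
  by apply: (@perm_inj _ p); have := e j; rewrite !ffunE.
rewrite -(card_imset _ injf); apply: eq_card => c'.
have [g fK gK] : bijective f := injF_bij injf.
rewrite -[c']gK mem_imset // !inE !history_eq //.
apply: eq_in_all => t; rewrite mem_iota /= add0n => tT.
congr (_ == _); apply/finset.setP => j; rewrite !inE ffunE.
have := congr1 (fun s => nth (p (next [::])) s t) ep.
rewrite -map_comp !(nth_map 0%N) ?size_iota // !nth_iota // add0n /= => <-.
by rewrite (inj_eq perm_inj).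
Qed.

(** What is found has the same distribution for all strategies that never open a cell
    twice; comparison with a strategy that ignores the answers makes this
    distribution explicit. *)
Lemma card_history (Q : pred (seq {set I})) next next' T :
  explores next T -> explores next' T ->
  #|[set c | Q (history next c T)]| = #|[set c | Q (history next' c T)]|.
Proof.
move=> ex ex'.
have sz nx c : size (history nx c T) == T by rewrite size_history.
suff card_sum nx : #|[set c | Q (history nx c T)]| =
    \sum_(h : T.-tuple {set I} | Q h) #|[set c | history nx c T == h]|.
  rewrite !card_sum; apply: eq_bigr => h _.
  by apply: card_history_fiber; rewrite ?size_tuple.
rewrite -sum1_card (partition_big (fun c => Tuple (sz nx c))
  (fun h : T.-tuple {set I} => Q h)) /=.
  apply: eq_bigr => h Qh; rewrite -sum1_card; apply: eq_bigl => c.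
  rewrite !inE -val_eqE /=; case: eqP => [->|]; by rewrite ?Qh // andbF.
by move=> c; rewrite inE.
Qed.

Lemma card_preim_ge (E : {set C}) (n : nat) :
  #|[set c : {ffun I -> C} | n <= #|[set j | c j \in E]|]| =
  \sum_(A : {set I} | n <= #|A|) #|E| ^ #|A| * (#|C| - #|E|) ^ (#|I| - #|A|).
Proof.
rewrite -sum1_card (partition_big (fun c : {ffun I -> C} => [set j | c j \in E])
  (fun A => n <= #|A|)) /=; last by move=> c; rewrite inE.
apply: eq_bigr => A nA; rewrite sum1_card.
pose F (j : I) : {pred C} := if j \in A then mem E else mem (~: E).
transitivity #|family F|.
  apply: eq_card => c; rewrite unfold_in inE.
  apply/andP/familyP => [[_ /eqP eA] j|cF].
    by rewrite /F -eA inE; case: ifPn => // cE; rewrite inE.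
  have eA : [set j | c j \in E] = A.
    apply/finset.setP => j; rewrite inE; have := cF j; rewrite /F; case: ifP => // _.
    by rewrite inE => /negbTE.
  by rewrite eA.
rewrite card_family foldrE big_map big_enum /= (bigID (mem A)) /=; congr (_ * _).
  rewrite (eq_bigr (fun=> #|E|)) ?prod_nat_const// => j jA.
  by rewrite /F jA.
rewrite (eq_bigr (fun=> #|C| - #|E|)) => [|j /negbTE jA].
  rewrite prod_nat_const; congr (_ ^ _).
  by rewrite -[A in RHS]finset.setCK -cardsCs; apply: eq_card => j; rewrite !inE.
by rewrite /F jA -[E in RHS]finset.setCK -cardsCs.
Qed.

End Exploration.

(** * Exploring the intervals one after the other *)

Section Blocks.
Variables (I : finType) (k m L : nat).
Local Notation C := ('I_m.+1 * 'I_L.+1)%type.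
Implicit Types (c : {ffun I -> C}) (h : seq {set I}).

(** Here and below there are [m.+1] blocks of [L.+1] cells, a block standing for an
    interval. *)
Definition block_count c (i l : nat) : nat :=
  #|[set j | ((c j).1 == i :> nat) && ((c j).2 < l)]|.

(** The value [L.+2] stands for a block holding fewer than [k] labels. *)
Definition stop c (i : nat) : nat :=
  find (fun l => k <= block_count c i l) (iota 0 L.+2).

(** The state is made of the current block, the number of cells already opened in
    it and the number of labels that they held.  The last block is never left, so
    that the strategy keeps opening new cells when all blocks are complete. *)
Definition step (st : nat * nat * nat) (s : {set I}) : nat * nat * nat :=
  let: (i, l, a) := st in
  if (k <= a + #|s|) && (i < m) then (i.+1, 0, 0) else (i, l.+1, a + #|s|).

Definition state h := foldl step (0, 0, 0) h.

Definition block_next h : C := (inord (state h).1.1, inord (state h).1.2).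

Definition found h : nat := \sum_(s <- h) #|s|.

Lemma state_rcons h s : state (rcons h s) = step (state h) s.
Proof. by rewrite /state -cats1 foldl_cat. Qed.

Lemma state_block_le h : (state h).1.1 <= m.
Proof.
elim/last_ind: h => [|h s]; first by [].
by rewrite state_rcons; case: (state h) => [[i l] a] /=; case: ifP => //= /andP[].
Qed.

Lemma state_cell_le h : (state h).1.2 <= size h.
Proof.
elim/last_ind: h => [|h s]; first by [].
by rewrite state_rcons size_rcons; case: (state h) => [[i l] a] /=; case: ifP.
Qed.

(** The rank of the cell in the lexicographic order of (block, cell) increases at
    each step; a block cannot overflow during the first [L.+1] steps. *)
Lemma block_next_explores (T : nat) : T <= L.+1 -> explores block_next T.
Proof.
move=> TL h hT.
pose code t := (state (take t h)).1.1 * L.+1 + (state (take t h)).1.2.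
have codeS t : t < T -> code t < code t.+1.
  move=> tT; rewrite /code (take_nth finset.set0) ?hT // state_rcons.
  have := state_cell_le (take t h); rewrite size_takel ?hT; last exact: ltnW.
  case: (state _) => [[i l] a] /= lt; case: ifP => _ /=; rewrite ?mulSn; lia.
have code_mono t d : t + d <= T -> code t + d <= code (t + d).
  elim: d => [|d IH]; first by rewrite !addn0.
  by rewrite !addnS => tT; apply: leq_ltn_trans (codeS _ tT); exact/IH/ltnW.
have code_inj t t' : t < T -> t' < T -> code t = code t' -> t = t'.
  move=> tT tT' e; case: (ltngtP t t') => // lt.
    by have := code_mono t (t' - t); rewrite subnKC 1?ltnW //; lia.
  by have := code_mono t' (t - t'); rewrite subnKC 1?ltnW //; lia.
rewrite map_inj_in_uniq ?iota_uniq // => t t'; rewrite !mem_iota !add0n /= => tT tT'.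
move=> /(congr1 (fun x : C => (x.1 : nat, x.2 : nat))) /=.
rewrite !inordK ?ltnS ?state_block_le //.
  by move=> -[e1 e2]; apply: code_inj => //; rewrite /code e1 e2.
  by apply: leq_trans (state_cell_le _) _; rewrite size_takel ?hT; lia.
by apply: leq_trans (state_cell_le _) _; rewrite size_takel ?hT; lia.
Qed.

Lemma block_count_mono c i l l' : l <= l' -> block_count c i l <= block_count c i l'.
Proof.
move=> ll; apply: subset_leq_card; apply/fintype.subsetP => j; rewrite !inE.
by case/andP => -> /= /leq_trans; apply.
Qed.

Lemma block_count0 c i : block_count c i 0 = 0.
Proof. by apply/eqP; rewrite cards_eq0; apply/eqP/finset.setP => j; rewrite !inE andbF. Qed.

Lemma block_countS c (i l : nat) (hi : i <= m) (hl : l <= L) :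
  block_count c i l.+1 = block_count c i l + #|[set j | c j == (inord i, inord l)]|.
Proof.
rewrite /block_count -cardsUI [X in _ + X](_ : _ = 0) ?addn0.
  apply: eq_card => j; rewrite !inE -pair_eqE /pair_eq /= -!val_eqE /= !inordK //.
  by case: eqP => //= _; rewrite ltnS leq_eqVlt orbC.
apply/eqP; rewrite cards_eq0; apply/eqP/finset.setP => j; rewrite !inE.
rewrite -pair_eqE /pair_eq /= -!val_eqE /= !inordK //; lia.
Qed.

Lemma stop_min c i l : l < stop c i -> block_count c i l < k.
Proof.
move=> ls; have := before_find 0 ls; rewrite nth_iota ?add0n.
  by move/negbT; rewrite -ltnNge.
by apply: leq_trans ls _; rewrite -[X in _ <= X](size_iota 0) find_size.
Qed.

Lemma stop_count c i : stop c i <= L.+1 -> k <= block_count c i (stop c i).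
Proof.
move=> sL; have hh : has (fun l => k <= block_count c i l) (iota 0 L.+2).
  by rewrite has_find size_iota.
by have := nth_find 0 hh; rewrite -/(stop c i) nth_iota.
Qed.

Lemma stop_le c i l : l <= L.+1 -> k <= block_count c i l -> stop c i <= l.
Proof.
by move=> lL; rewrite leqNgt [in X in _ -> X]leqNgt; apply: contra => /stop_min.
Qed.


Hypothesis k_gt0 : 0 < k.

(** What the state means in terms of the configuration: the blocks before [i] were
    each opened up to their stopping cell. *)
Definition reached c (T i l a : nat) : Prop :=
  [/\ i <= m, \sum_(i' < i) stop c i' + l = T, a = block_count c i l &
      i < m -> a < k].

Lemma stopE c (i l : nat) : l <= L ->
  block_count c i l < k -> k <= block_count c i l.+1 -> stop c i = l.+1.
Proof.
move=> lL lt_k le_k; have sl := @stop_le c i l.+1 lL le_k.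
apply/eqP; rewrite eqn_leq sl /= ltnNge; apply/negP => sl'.
have := stop_count (leq_trans sl' (leqW lL)).
by move=> /leq_trans /(_ (block_count_mono _ _ sl')); lia.
Qed.

Lemma state_history c T : T <= L.+1 ->
  let h := history block_next c T in
  let: (i, l, a) := state h in
  reached c T i l a /\
  found h = \sum_(i' < i) block_count c i' (stop c i') + a.
Proof.
elim: T => [|T IH] TL /=.
  split; last by rewrite /found big_nil big_ord0.
  by split; rewrite ?big_ord0 ?block_count0.
move: IH => /(_ (ltnW TL)); set h := history _ _ _ => /=.
rewrite state_rcons /block_next /found big_rcons /=.
case: (state h) => [[i l] a] /= [[im sT ea ak] ef].
have lL : l <= L by lia.
set s := [set j | _]; have es : block_count c i l.+1 = a + #|s|.
  by rewrite block_countS // ea.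
rewrite ef.
case: ifP => [/andP[ks lim]|/negbT]; last first.
  rewrite negb_and => H; split; last by lia.
  split => //; first by lia.
  by move=> lim; move: H; rewrite lim orbF -ltnNge.
have e : stop c i = l.+1 by apply: stopE => //; [rewrite -ea ak|rewrite es].
split; last by rewrite big_ord_recr /= e es; lia.
split => //; first by rewrite big_ord_recr /= e addn0 addnS -sT.
by rewrite block_count0.
Qed.

(** The [T] first cells opened reveal the [k]-th label of every block. *)
Definition finished c (T : nat) : bool := \sum_(i < m.+1) stop c i <= T.

Lemma reached_last c T i l a : T <= L.+1 -> reached c T i l a ->
  finished c T -> i = m.
Proof.
move=> TL [im sT ea ak] dT; apply/eqP; rewrite eqn_leq im leqNgt; apply/negP => lim.
have ls : l < stop c i.
  rewrite ltnNge; apply/negP => sl.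
  have sL : stop c i <= L.+1 by lia.
  have := leq_trans (stop_count sL) (block_count_mono _ _ sl).
  by have := ak lim; lia.
move: dT; rewrite /finished leqNgt => /negP; apply.
rewrite -sT -(big_mkord xpredT (stop c)) -(big_mkord xpredT (stop c)).
have -> : \sum_(0 <= i' < m.+1) stop c i' = \sum_(0 <= i' < i) stop c i' +
    stop c i + \sum_(i.+1 <= i' < m.+1) stop c i'.
  by rewrite (big_cat_nat (n := i.+1)) // big_nat_recr.
lia.
Qed.

(** Every block, the last one included, contributes at least [k] labels. *)
Lemma finished_found c T : T <= L.+1 -> finished c T ->
  k * m.+1 <= found (history block_next c T).
Proof.
move=> TL dT; have := state_history c TL => /=.
case: (state _) => [[i l] a] [re ->]; have ei := reached_last TL re dT.
case: re => im sT ea _; move: dT; rewrite /finished big_ord_recr /= -ei -sT.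
rewrite leq_add2l => sl.
have lL : l <= L.+1 by lia.
have ka : k <= a.
  by rewrite ea; apply: leq_trans (block_count_mono _ _ sl); apply/stop_count/(leq_trans sl).
have stops (i' : 'I_i) : stop c i' <= L.+1.
  have := leq_addr l (\sum_(i'' < i) stop c i''); rewrite sT (bigD1 i') //=; lia.
suff : i * k <= \sum_(i' < i) block_count c i' (stop c i').
  by move=> H; rewrite mulnS mulnC addnC leq_add.
rewrite -[in i * k](card_ord i) -sum_nat_const; apply: leq_sum => i' _.
exact: stop_count.
Qed.

Lemma block_count_inj c i l : injective c ->
  block_count c i l.+1 <= (block_count c i l).+1.
Proof.
move=> ci.
have [hi|hi] := leqP i m; last first.
  rewrite (_ : block_count c i l.+1 = 0) //.
  apply/eqP; rewrite cards_eq0; apply/eqP/finset.setP => j; rewrite !inE.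
  by have := ltn_ord (c j).1; lia.
have [hl|hl] := leqP l L; last first.
  apply/leqW/subset_leq_card/fintype.subsetP => j; rewrite !inE => /andP[-> _] /=.
  exact: leq_trans (ltn_ord (c j).2) hl.
rewrite block_countS // -[X in _ <= X]addn1 leq_add2l.
by apply/card_le1_eqP => j j'; rewrite !inE => /eqP e /eqP e'; apply: ci; rewrite e e'.
Qed.

Lemma stop_count_inj c i : injective c -> stop c i <= L.+1 ->
  block_count c i (stop c i) <= k.
Proof.
move=> ci sL; case e: (stop c i) => [|l]; first by rewrite block_count0.
apply: leq_trans (block_count_inj _ _ ci) _.
by apply: stop_min; rewrite e.
Qed.

(** When no cell holds two labels, a block is left with exactly [k] labels, so that
    [k * m.+1] labels cannot be found before the last block is complete. *)
Lemma found_finished c T : injective c -> T <= L.+1 ->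
  k * m.+1 <= found (history block_next c T) -> finished c T.
Proof.
move=> ci TL; have := state_history c TL => /=.
case: (state _) => [[i l] a] [[im sT ea ak] ->].
have stops (i' : 'I_i) : stop c i' <= L.+1.
  have := leq_addr l (\sum_(i'' < i) stop c i''); rewrite sT (bigD1 i') //=; lia.
have le_ik : \sum_(i' < i) block_count c i' (stop c i') <= i * k.
  rewrite -[in i * k](card_ord i) -sum_nat_const; apply: leq_sum => i' _.
  exact: stop_count_inj.
move=> le_km; have ei : i = m.
  apply/eqP; rewrite eqn_leq im leqNgt; apply/negP => lim.
  have := ak lim; have : i.+1 * k <= m * k by rewrite leq_mul2r lim orbT.
  move: le_km le_ik; rewrite mulSn mulnS [k * m]mulnC; move: (\sum_(_ < _) _) => S; lia.
rewrite /finished big_ord_recr /= -ei -sT leq_add2l; apply: stop_le; first by lia.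
rewrite -ea; move: le_km le_ik; rewrite -ei mulnS [k * i]mulnC.
by move: (\sum_(_ < _) _) => S; lia.
Qed.


(** A strategy that ignores the answers, for which what is found is easily counted. *)
Definition fixed_next (x0 : C) h : C := nth x0 (enum {: C}) (size h).

Lemma fixed_next_explores x0 T : T <= #|{: C}| -> explores (fixed_next x0) T.
Proof.
move=> TC h hT; rewrite map_inj_in_uniq ?iota_uniq // => t t'.
rewrite !mem_iota !add0n /= => tT tT' /eqP.
rewrite /fixed_next !size_takel ?hT ?(ltnW tT) ?(ltnW tT') //.
by rewrite nth_uniq ?enum_uniq -?cardE ?(leq_trans tT) ?(leq_trans tT') // => /eqP.
Qed.

Lemma found_fixed x0 c T : T <= #|{: C}| ->
  found (history (fixed_next x0) c T) =
  #|[set j | c j \in [set x in take T (enum {: C})]]|.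
Proof.
elim: T => [|T IH] TC.
  rewrite /found big_nil; apply/esym/eqP; rewrite cards_eq0; apply/eqP/finset.setP => j.
  by rewrite !inE take0.
rewrite historyS /found big_rcons -/(found _) IH ?(ltnW TC) //.
rewrite {1}/fixed_next size_history (take_nth x0) -?cardE //.
rewrite [LHS]/= -cardsUI [X in _ + X = _](_ : _ = 0) ?addn0.
  apply: eq_card => j; rewrite !inE mem_rcons inE orbC //.
apply/eqP; rewrite cards_eq0; apply/eqP/finset.setP => j; rewrite !inE.
apply/negbTE; rewrite negb_and; case: (eqVneq (c j) _) => [->|_]; rewrite ?orbT //.
have := take_uniq T.+1 (enum_uniq {: C}).
by rewrite (take_nth x0) -?cardE // rcons_uniq => /andP[->].
Qed.

Lemma card_first_cells T : T <= #|{: C}| -> #|[set x in take T (enum {: C})]| = T.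
Proof.
move=> TC; rewrite cardsE (card_uniqP _) ?take_uniq ?enum_uniq //.
by rewrite size_takel // -cardE.
Qed.

Lemma card_found T : T <= L.+1 ->
  #|[set c | k * m.+1 <= found (history block_next c T)]| =
  \sum_(A : {set I} | k * m.+1 <= #|A|)
     T ^ #|A| * (m.+1 * L.+1 - T) ^ (#|I| - #|A|).
Proof.
move=> TL; have cardC : #|{: C}| = m.+1 * L.+1 by rewrite card_prod !card_ord.
have TC : T <= #|{: C}| by rewrite cardC; nia.
have exb := block_next_explores TL.
have exf := @fixed_next_explores (ord0, ord0) T TC.
rewrite (card_history (fun h => k * m.+1 <= found h) exb exf).
pose E : {set C} := [set x in take T (enum {: C})].
transitivity #|[set c : {ffun I -> C} | k * m.+1 <= #|[set j | c j \in E]|]|.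
  by apply: eq_card => c; rewrite !inE found_fixed.
by rewrite card_preim_ge card_first_cells // cardC.
Qed.

End Blocks.

(** * The beta distribution function as a binomial tail *)

Local Open Scope classical_set_scope.
Local Open Scope ring_scope.

Section BetaCdf.
Variable R : realType.
Local Notation mu := (@lebesgue_measure R).

(** Both the abstract Radon-Nikodym derivative and the density have the beta law as
    indefinite integral, hence are equal almost everywhere.  Working with nonnegative
    functions allows infinite integrals. *)
Lemma ge0_integral_beta_prob (a b : nat) (U : set (measurableTypeR R))
    (f : measurableTypeR R -> \bar R) :
  measurable U -> measurable_fun U f -> (forall x, 0 <= f x)%E ->
  (\int[beta_prob a b]_(x in U) f x =
   \int[mu]_(x in U) (f x * (beta_pdf a b x)%:E))%E.
Proof.
move=> mU mf f0.
rewrite -(Radon_Nikodym_SigmaFinite.change_of_variables (beta_prob_dom a b)) //=.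
apply: ae_eq_integral => //.
- apply: emeasurable_funM => //; apply: (measurable_int mu).
  apply: (integrableS _ _ (@subsetT _ _)) => //=.
  by apply: Radon_Nikodym_SigmaFinite.f_integrable; exact: beta_prob_dom.
- apply: emeasurable_funM => //=; apply/measurableT_comp => //=.
  by apply/measurable_funTS; exact: measurable_beta_pdf.
- apply: ae_eqe_mul2l => /=.
  have bd := @beta_prob_dom R a b.
  apply: integral_ae_eq => //=.
  + apply: integrableS (Radon_Nikodym_SigmaFinite.f_integrable bd) => //.
  + by apply/measurable_funTS/measurableT_comp =>//; exact: measurable_beta_pdf.
  + by move=> E E01 mE; rewrite -Radon_Nikodym_SigmaFinite.f_integral// integral_beta_pdf.
Qed.

(** The probability that a binomial variable with [N] trials is at least [n], as a
    polynomial in the success probability. *)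
Definition binomial_tail (N n : nat) : {poly R} :=
  \sum_(n <= j < N.+1) 'C(N, j)%:R *: ('X^j * (1 - 'X) ^+ (N - j)).

(** The derivative of the [j]-th term is [D j - D j.+1], where [D j] is the
    right-hand side with [j] in place of [n], so only [D n] survives. *)
Lemma deriv_binomial_tail (N n : nat) : (n <= N.+1)%N ->
  (binomial_tail N n)^`() = (n * 'C(N, n))%:R *: ('X^(n.-1) * (1 - 'X) ^+ (N - n)).
Proof.
move=> nN.
pose D j : {poly R} := (j * 'C(N, j))%:R *: ('X^(j.-1) * (1 - 'X) ^+ (N - j)).
rewrite /binomial_tail linear_sum /= -/(D n).
transitivity (\sum_(n <= j < N.+1) (- D j.+1 - - D j)); last first.
  rewrite (telescope_sumr (fun j => - D j)) // opprK.
  by rewrite {1}/D bin_small// muln0 scale0r oppr0 add0r.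
apply: eq_big_nat => j /andP[_ jN].
rewrite derivZ derivM derivXn deriv_exp derivB derivX derivC sub0r opprK addrC.
rewrite scalerDr /D /= mul_bin_left; congr (_ + _).
  rewrite subnS mulN1r mulNrn mulrN scalerN mulrnAr -scalerMnr scalerMnl.
  by rewrite -mulr_natr -natrM mulnC.
by rewrite mulrnAl -scalerMnr scalerMnl -mulr_natr -natrM mulnC.
Qed.

Lemma binomial_tail0 (N n : nat) : (0 < n)%N -> (binomial_tail N n).[0] = 0.
Proof.
move=> n0; rewrite /binomial_tail horner_sum big_nat_cond big1 // => j /andP[/andP[nj _] _].
by rewrite !hornerE expr0n; case: j nj => [|j _] /=; [lia|rewrite mulr0 mul0r].
Qed.


Lemma beta_prob_ray (a b : nat) (t : R) : 0 <= t <= 1 ->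
  beta_prob a.+1 b.+1 `]-oo, t] = ((binomial_tail (a + b).+1 a.+1).[t])%:E.
Proof.
move=> /andP[t0 t1]; set p := binomial_tail _ _.
have p0 : p.[0] = 0 by exact: binomial_tail0.
have dp x : p^`().[x] = XMonemX a b x / beta_fun a.+1 b.+1.
  rewrite deriv_binomial_tail; last by lia.
  rewrite !hornerE /XMonemX /unstable.onem /= beta_fun_fact.
  have -> : ((a + b).+1 - a.+1 = b)%N by lia.
  have := @bin_fact (a + b).+1 a.+1; rewrite subSS addKn => <-; last by lia.
  rewrite factS !natrM.
  have h1 : a`!%:R != 0 :> R by rewrite pnatr_eq0 -lt0n fact_gt0.
  have h2 : b`!%:R != 0 :> R by rewrite pnatr_eq0 -lt0n fact_gt0.
  have h3 : 'C((a + b).+1, a.+1)%:R != 0 :> R by rewrite pnatr_eq0 -lt0n bin_gt0; lia.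
  have h4 : 1 + a%:R != 0 :> R by rewrite -mulrS pnatr_eq0.
  by field; rewrite h1 h2 h3 h4.
rewrite -integral_beta_pdf // /beta_pdf.
transitivity (\int[mu]_(x in `[0%R, t]) (p^`().[x])%:E)%E.
  rewrite [LHS]integral_mkcond [RHS]integral_mkcond; apply: eq_integral => x _.
  rewrite /= !patchE !mem_setE !in_itv /= dp.
  case: (leP x t) => xt; last by rewrite andbF.
  rewrite (le_trans xt t1) !andbT; case: ifP => // _.
  by congr EFin; exact: mul0r.
move: t0; rewrite le_eqVlt => /predU1P[<-|t0].
  by rewrite set_itv1 integral_set1 p0.
rewrite (continuous_FTC2 (F := horner p)) //; first by rewrite p0 sube0.
- by apply: continuous_subspaceT => x; exact: continuous_horner.
- split.
  + by move=> x _; exact: derivable_horner.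
  + by apply: cvg_at_right_filter; exact: continuous_horner.
  + by apply: cvg_at_left_filter; exact: continuous_horner.
- by move=> x _; rewrite derivE.
Qed.
End BetaCdf.

(** * Squared error under the beta law *)

Section BetaMoments.
Variable R : realType.
Local Notation mu := (@lebesgue_measure R).

(** Continuity away from 0 is enough, a single point being harmless. *)
Lemma measurable_fun_invr : measurable_fun [set: R] (@GRing.inv R).
Proof.
rewrite -(setvU [set (0:R)]); apply/measurable_funU => //.
  exact: measurableC.
split; last exact: measurable_fun_set1.
apply: open_continuous_measurable_fun; 
  first exact/closed_openC/(compact_closed (@Rhausdorff R))/compact_set1.
by move=> x /set_mem /= /eqP x0; exact: inv_continuous.
Qed.

Lemma integral_beta_pdf_restrict (a b : nat) (f : R -> R) :
  (\int[mu]_x ((f x)%:E * (beta_pdf a.+1 b.+1 x)%:E) =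
  \int[mu]_(x in `[0%R, 1%R]) (f x * (XMonemX a b x / beta_fun a.+1 b.+1))%:E)%E.
Proof.
rewrite [RHS]integral_mkcond; apply: eq_integral => x _ /=.
rewrite patchE /beta_pdf patchE; case: ifPn => // _.
by rewrite [X in (X / _)%:E](_ : _ = 0) // mul0r mule0.
Qed.

Lemma integral_XMonemX (a b : nat) :
  (\int[mu]_(x in `[0%R, 1%R]) (XMonemX a b x)%:E = (beta_fun a.+1 b.+1)%:E)%E.
Proof. by rewrite EFin_beta_fun integral_XMonemX_restrict setTI. Qed.

Lemma beta_funS_ratio (a b : nat) :
  beta_fun a.+2 b.+1 = a.+1%:R / (a + b).+2%:R * beta_fun a.+1 b.+1 :> R.
Proof.
rewrite !beta_fun_fact addSn !factS !natrM.
have h1 : ((a + b)`!%:R : R) != 0 by rewrite pnatr_eq0 -lt0n fact_gt0.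
by field; rewrite h1 -natrD -mulrS -natrD !pnatr_eq0.
Qed.

(** Markov's inequality, the right-hand side being the mean of the beta law. *)
Lemma beta_tail_le (a b : nat) (c : R) : 0 < c ->
  (c%:E * beta_prob a.+1 b.+1 `[c, +oo[ <= (a.+1%:R / (a + b).+2%:R)%:E)%E.
Proof.
move=> c0; set P := beta_prob _ _.
have B0 : 0 < beta_fun a.+1 b.+1 :> R by exact: beta_fun_gt0.
have -> : ((a.+1%:R / (a + b).+2%:R)%:E = \int[P]_x `|x%:E|)%E.
  rewrite ge0_integral_beta_prob //; last exact: measurableT_comp.
  rewrite (integral_beta_pdf_restrict a b (fun x => `|x|)).
  transitivity (\int[mu]_(x in `[0%R, 1%R])
      ((beta_fun a.+1 b.+1)^-1%:E * (XMonemX a.+1 b x)%:E))%E.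
    rewrite integralZl//; last exact: integrable_XMonemX.
    by rewrite integral_XMonemX -EFinM beta_funS_ratio mulrCA mulVf ?mulr1 // gt_eqF.
  apply: eq_integral => x; rewrite inE /= in_itv /= => /andP[x0 x1].
  by rewrite ger0_norm // /XMonemX -EFinM exprS; congr EFin; ring.
rewrite -integral_cst //.
apply: (@le_trans _ _ (\int[P]_(x in `[c, +oo[) `|x%:E|)%E).
  apply: ge0_le_integral => //.
  - by move=> x _; rewrite lee_fin ltW.
  - by apply/measurable_funTS/measurableT_comp.
  - move=> x; rewrite /= in_itv /= andbT => cx.
    by rewrite lee_fin (le_trans cx) // ler_norm.
by apply: ge0_subset_integral => //; exact: measurableT_comp.
Qed.

Lemma measurable_sq_err (u v : R) : measurable_fun [set: R] (fun x => (u / x - v) ^+ 2).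
Proof.
apply: measurable_funX; apply: measurable_funB => //.
by apply: measurable_funM => //; exact: measurable_fun_invr.
Qed.

(** Expanding the square lowers the first exponent of the density by 2, 1 and 0; the
    three integrals are beta functions with integer arguments.  The assumption that
    this argument is at least 3 keeps the exponents nonnegative. *)
Lemma beta_sq_err (q b : nat) :
  let N : R := (q + b).+3%:R in
  (\int[beta_prob q.+3 b.+1]_x (((q.+2%:R / x - N) ^+ 2)%R%:E) =
   ((N ^+ 2 - q.+2%:R * N) / q.+1%:R)%R%:E)%E.
Proof.
move=> N; rewrite ge0_integral_beta_prob //; last 2 first.
- by apply/measurable_EFinP; exact: measurable_sq_err.
- by move=> x; rewrite lee_fin sqr_ge0.
(* At 0, where the inverse is 0, the expansion of the square fails. *)
rewrite integral_beta_pdf_restrict -integral_itv_obnd_cbnd; last first.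
  apply/measurable_EFinP/measurable_funTS/measurable_funM.
    exact: measurable_sq_err.
  by apply: measurable_funM => //; exact: measurable_XMonemX.
pose B := beta_fun q.+3 b.+1 : R.
transitivity (\int[mu]_(x in `]0%R, 1%R])
   (((q.+2%:R ^+ 2 / B)%:E * (XMonemX q b x)%:E +
     (- (2 * q.+2%:R * N) / B)%:E * (XMonemX q.+1 b x)%:E)
     + (N ^+ 2 / B)%:E * (XMonemX q.+2 b x)%:E))%E.
  apply: eq_integral => x; rewrite inE /= in_itv /= => /andP[x0 x1].
  rewrite -!EFinM -!EFinD; congr EFin; rewrite /XMonemX !exprS.
  have x0' : x != 0 by rewrite gt_eqF.
  have B0 : B != 0 by rewrite gt_eqF // beta_fun_gt0.
  rewrite -/B; move: (_.+2%:R) N B B0 (x ^+ q) (_ ^+ b) => u v w w0 y z.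
  by field; rewrite w0.
have iX i r : mu.-integrable `[0, 1] (fun x => (r%:E * (XMonemX i b x)%:E)%E).
  by apply: integrableZl => //; exact: integrable_XMonemX.
rewrite integral_itv_obnd_cbnd; last first.
  apply/measurable_funTS; do 2 ?apply: emeasurable_funD => //;
    by apply: measurable_funeM; apply/measurable_EFinP; exact: measurable_XMonemX.
rewrite integralD //; last exact: integrableD.
rewrite integralD // !integralZl //; try exact: integrable_XMonemX.
rewrite !integral_XMonemX -!EFinM -!EFinD; congr EFin.
rewrite /B (beta_funS_ratio q.+1) (beta_funS_ratio q) /N.
have B0 : beta_fun q.+1 b.+1 != 0 :> R by rewrite gt_eqF // beta_fun_gt0.
have h n : n.+1%:R != 0 :> R by rewrite pnatr_eq0.
rewrite addSn.
have e : (q + b).+3%:R = (q+b).+2%:R + 1 :> R by rewrite -addn1 natrD.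
have e' : q.+2%:R = q.+1%:R + 1 :> R by rewrite -addn1 natrD.
have h' := h (q+b).+1; have h'' := h (q+b).+2; have h3 := h q; have h4 := h q.+1.
move: h' h'' h3 h4; rewrite e e'; move: (_.+2%:R : R) (q.+1%:R : R) => u v *.
by field; apply/and5P.
Qed.

Lemma integral_invr_pinfty (c d : R) : 0 < c -> 0 < d ->
  (\int[mu]_(x in `]0%R, d]) ((c * x^-1)%R%:E) = +oo)%E.
Proof.
move=> c0 d0; apply/eqyP => M M0.
(* With this e, the integral of c / x over [e, d] is exactly M. *)
pose e := d * expR (- (M / c)).
have e0 : 0 < e by rewrite mulr_gt0 ?expR_gt0.
have ed : e < d.
  rewrite /e -[ltRHS]mulr1 ltr_pM2l // -expR0 ltr_expR oppr_lt0.
  by rewrite divr_gt0.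
have lt0 x : x \in `[e, d] -> 0 < x.
  by rewrite in_itv /= => /andP[ex _]; exact: lt_le_trans ex.
have mf : measurable_fun [set: R] (fun x => (c * x^-1)%:E).
  by apply/measurable_EFinP/measurable_funM => //; exact: measurable_fun_invr.
apply: (@le_trans _ _ (\int[mu]_(x in `[e, d]) (c * x^-1)%:E)%E); last first.
  apply: ge0_subset_integral => //.
  - exact: measurable_funTS.
  - by move=> x; rewrite /= in_itv /= => /andP[x0 _];
      rewrite lee_fin mulr_ge0 ?invr_ge0 //; exact: ltW.
  - move=> x; rewrite /= !in_itv /= => /andP[ex ->]; rewrite andbT.
    exact: lt_le_trans ex.
rewrite (continuous_FTC2 (F := fun x => c * ln x)) //.
- rewrite -EFinB lee_fin -mulrBr /e lnM ?posrE ?expR_gt0 // expRK.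
  by rewrite opprD addNKr opprK mulrC divfK // gt_eqF.
- apply: continuous_in_subspaceT => x /set_mem xed.
  apply: cvgM; first exact: cvg_cst.
  by apply: inv_continuous; rewrite gt_eqF // lt0.
- split.
  + move=> x /subset_itv_oo_cc /lt0 x0.
    by apply: derivableM => //; apply: ex_derive; exact: is_derive1_ln.
  + apply: cvg_at_right_filter; apply: cvgM; first exact: cvg_cst.
    exact: continuous_ln.
  + apply: cvg_at_left_filter; apply: cvgM; first exact: cvg_cst.
    exact: continuous_ln.
- move=> x /subset_itv_oo_cc /lt0 x0.
  have dln := is_derive1_ln x0.
  have : is_derive x (1 : R) (fun x => c * ln x) (c * x^-1).
    by apply: is_derive_eq.
  by move=> H; rewrite derive1E derive_val.
Qed.

(** Near 0 the integrand dominates a multiple of [x^-1]: the square is at least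
    [(2 * x)^-2] as soon as [1 / x >= 2 * N], and the density is at least a multiple
    of [x]. *)
Lemma beta_sq_err_pinfty (b : nat) (N : R) :
  (\int[beta_prob 2 b.+1]_(x in `]-oo, 1%R[) (((1 / x - N) ^+ 2)%R%:E) = +oo)%E.
Proof.
set P := beta_prob _ _.
have B0 : 0 < beta_fun 2 b.+1 :> R by exact: beta_fun_gt0.
(* For x <= d both 1 / x >= 2 * N and x <= 1 / 2 hold. *)
pose d : R := (2 * (`|N| + 1))^-1.
have N0 : 0 < `|N| + 1 by rewrite ltr_wpDl.
have d0 : 0 < d by rewrite invr_gt0 mulr_gt0.
have d1 : d <= 2^-1.
  by rewrite lef_pV2 ?posrE ?mulr_gt0 // ler_peMr // lerDr.
pose c : R := 2^-1 ^+ b / (4 * beta_fun 2 b.+1).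
have c0 : 0 < c by rewrite divr_gt0 ?exprn_gt0 ?mulr_gt0.
rewrite ge0_integral_beta_prob //; last 2 first.
- by apply/measurable_funTS/measurable_EFinP; exact: measurable_sq_err.
- by move=> x; rewrite lee_fin sqr_ge0.
apply/eqP; rewrite -leye_eq -(integral_invr_pinfty c0 d0).
have mf : measurable_fun [set: R]
    (fun x => ((1 / x - N) ^+ 2)%:E * (beta_pdf 2 b.+1 x)%:E)%E.
  apply: emeasurable_funM; apply/measurable_EFinP.
    exact: measurable_sq_err.
  exact: measurable_beta_pdf.
have f0 x : (0 <= ((1 / x - N) ^+ 2)%:E * (beta_pdf 2 b.+1 x)%:E)%E.
  by rewrite mule_ge0 // lee_fin ?sqr_ge0 // beta_pdf_ge0.
apply: (@le_trans _ _ (\int[mu]_(x in `]0%R, d])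
    (((1 / x - N) ^+ 2)%:E * (beta_pdf 2 b.+1 x)%:E))%E); last first.
  apply: ge0_subset_integral => //; first exact: measurable_funTS.
  move=> x; rewrite /= !in_itv /= => /andP[_ xd].
  by apply: le_lt_trans xd (le_lt_trans d1 _); rewrite invf_lt1 // ltr1n.
apply: ge0_le_integral => //.
- move=> x; rewrite /= in_itv /= => /andP[x0 _].
  by rewrite lee_fin mulr_ge0 ?invr_ge0 //; exact: ltW.
- apply/measurable_funTS/measurable_EFinP/measurable_funM => //.
  exact: measurable_fun_invr.
- exact: measurable_funTS.
move=> x; rewrite /= in_itv /= => /andP[x0 xd].
have x12 : x <= 2^-1 := le_trans xd d1.
have x1 : x <= 1 by apply: le_trans x12 _; rewrite invf_le1 // ler1n.
rewrite -EFinM lee_fin /beta_pdf patchE mem_setE in_itv /= (ltW x0) x1 /= /XMonemX expr1.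
have h1 : 2^-1 * x^-1 <= 1 / x - N.
  have : 2 * (`|N| + 1) <= x^-1.
    by rewrite -[leLHS]invrK lef_pV2 // posrE.
  by have := ler_norm N; rewrite mul1r; set y := x^-1; lra.
have h2 : (2^-1 * x^-1) ^+ 2 <= (1 / x - N) ^+ 2.
  by rewrite ler_sqr ?nnegrE // ?(le_trans _ h1) // mulr_ge0 // invr_ge0 ltW.
have h3 : 2^-1 ^+ b <= unstable.onem x ^+ b.
  by rewrite lerXn2r ?nnegrE ?invr_ge0 // /unstable.onem; lra.
apply: (@le_trans _ _ ((2^-1 * x^-1) ^+ 2 * (x * 2^-1 ^+ b / beta_fun 2 b.+1))).
  rewrite le_eqVlt; apply/orP; left; apply/eqP; rewrite /c.
  have x0' : x != 0 by rewrite gt_eqF.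
  by field; rewrite x0' gt_eqF.
apply: ler_pM => //.
- by rewrite sqr_ge0.
- by rewrite divr_ge0 ?mulr_ge0 ?exprn_ge0 ?invr_ge0 ?ltW.
by rewrite ler_pM2r ?invr_gt0 // ler_pM2l.
Qed.
End BetaMoments.

(** * Order statistics of an interval *)

Section OrderStat.
Variables (R : realType) (m n : nat).
Implicit Types (i : 'I_m.+1) (u : 'I_n -> R).

Lemma count_values_in i u (z : R) : z < i.+1%:R / m.+1%:R ->
  count (<= z) (values_in i u) = #|[pred j | (i%:R / m.+1%:R <= u j) && (u j <= z)]|.
Proof.
move=> zi; rewrite -sum1_count /values_in big_map big_filter_cond big_enum_cond /=.
rewrite sum1_card; apply: eq_card => j; rewrite !inE unfold_in /= -andbA.
by case: (leP (u j) z) => uz; rewrite ?andbF // (le_lt_trans uz zi).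
Qed.

Lemma values_inP i u x : x \in values_in i u ->
  i%:R / m.+1%:R <= x < i.+1%:R / m.+1%:R.
Proof. by move=> /mapP[j]; rewrite mem_filter => /andP[uj _] ->. Qed.

(** Comparing the [k]-th smallest value with [z] amounts to counting the values up to
    [z]; below the right end of the interval, the default value does not interfere. *)
Lemma Zstat_le k i u (z : R) : (0 < k)%N -> z < i.+1%:R / m.+1%:R ->
  (Zstat k i u <= z) =
  (k <= #|[pred j | ((i%:R / m.+1%:R <= u j) && (u j <= z))%R]|)%N.
Proof.
move=> k0 zi; rewrite -count_values_in // /Zstat.
set v := values_in i u; pose s := sort <=%R v.
have -> : count (<= z) v = count (<= z) s by apply/esym/seq.permP; rewrite perm_sort.
have ss : sorted <=%R s by exact: sort_le_sorted.
have [ks|ks] := leqP k (count (<= z) s).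
  by apply: nth_count_le => //; rewrite prednK.
apply/negbTE; rewrite -ltNge.
have [sz|sz] := ltnP k.-1 (size s); last by rewrite nth_default.
by apply: nth_count_gt => //; rewrite sz andbT -ltnS prednK.
Qed.

Lemma Zstat_bounds k i u :
  i%:R / m.+1%:R <= Zstat k i u <= i.+1%:R / m.+1%:R.
Proof.
rewrite /Zstat; set s := sort _ _.
have [sz|sz] := ltnP k.-1 (size s); last first.
  by rewrite nth_default // lexx ler_pM2r ?invr_gt0 ?ltr0n // ler_nat leqnSn.
have := mem_nth (i.+1%:R / m.+1%:R) sz; rewrite mem_sort => /values_inP.
by case/andP => -> /ltW ->.
Qed.

Lemma Xstat_bounds k i u : 0 <= Xstat k i u <= m.+1%:R^-1.
Proof.
have /andP[h1 h2] := Zstat_bounds k i u.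
rewrite /Xstat subr_ge0 h1 lerBlDr (le_trans h2) //.
by rewrite -natr1 mulrDl mul1r addrC.
Qed.
End OrderStat.

(** * Values located on a grid *)

Section Grid.
Variables (R : realType) (k m L n : nat).
Hypothesis k_gt0 : (0 < k)%N.
Local Notation C := ('I_m.+1 * 'I_L.+1)%type.
Implicit Types (i : 'I_m.+1) (u : 'I_n -> R) (c : {ffun 'I_n -> C}).

Definition grid (p : nat) : R := p%:R / (m.+1 * L.+1)%:R.

(** Cell [p] is the interval between [grid p] and [grid p.+1]. *)
Definition cell_index (x : C) : nat := (x.1 * L.+1 + x.2)%N.

Definition in_cells u c : bool :=
  [forall j, grid (cell_index (c j)) <= u j < grid (cell_index (c j)).+1].

Lemma ltr_grid p q : (grid p < grid q) = (p < q)%N.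
Proof. by rewrite ltr_pM2r ?invr_gt0 ?ltr0n ?muln_gt0 // ltr_nat. Qed.

Lemma ler_grid p q : (grid p <= grid q) = (p <= q)%N.
Proof. by rewrite ler_pM2r ?invr_gt0 ?ltr0n ?muln_gt0 // ler_nat. Qed.

Lemma gridD p q : grid (p + q) = grid p + grid q.
Proof. by rewrite /grid natrD mulrDl. Qed.

Lemma grid_block (i : nat) : grid (i * L.+1) = i%:R / m.+1%:R.
Proof.
by rewrite /grid !natrM invfM mulrACA divff ?mulr1 // pnatr_eq0.
Qed.

Lemma in_cells_lt u c j (p : nat) : in_cells u c ->
  (u j < grid p) = (cell_index (c j) < p)%N.
Proof.
move=> /forallP /(_ j) /andP[h1 h2]; have [cp|pc] := ltnP.
  by apply: lt_le_trans h2 _; rewrite ler_grid.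
by apply/negbTE; rewrite -leNgt (le_trans _ h1) // ler_grid.
Qed.

Lemma block_count_grid u c i (l : nat) : in_cells u c -> (l <= L.+1)%N ->
  block_count c i l =
  #|[pred j | (i%:R / m.+1%:R <= u j) && (u j < grid (i * L.+1 + l))]|.
Proof.
move=> uc lL; rewrite /block_count cardsE; apply: eq_card => j; rewrite !inE -grid_block leNgt.
rewrite !(in_cells_lt _ _ uc) /cell_index -leqNgt.
transitivity ((nat_of_ord (c j).1 == i) && ((c j).2 < l)%N); first by [].
have := ltn_ord (c j).2; move: (nat_of_ord (c j).1) (nat_of_ord (c j).2) => x y yL.
apply/andP/andP.
  by move=> [/eqP -> yl]; rewrite leq_addr ltn_add2l.
move=> [h1 h2]; suff e : x = i by move: h2; rewrite e eqxx ltn_add2l.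
case: (ltngtP x i) => // xi; [move: h1|move: h2].
  have : (x.+1 * L.+1 <= i * L.+1)%N by rewrite leq_mul2r xi orbT.
  by rewrite mulSn; lia.
have : (i.+1 * L.+1 <= x * L.+1)%N by rewrite leq_mul2r xi orbT.
by rewrite mulSn; lia.
Qed.

(** Together with [stop_le_Xstat]: the stopping cell locates the order statistic up to
    one cell width. *)
Lemma Xstat_le_stop u c i : in_cells u c -> (stop k c i <= L.+1)%N ->
  Xstat k i u <= grid (stop k c i).
Proof.
move=> uc sL; have := stop_count sL; rewrite (block_count_grid _ uc) // => kc.
rewrite /Xstat lerBlDr -grid_block -gridD addnC.
have [e|ne] := eqVneq (stop k c i) L.+1.
  by rewrite e -mulSnr grid_block; have /andP[] := Zstat_bounds k i u.
rewrite Zstat_le //; last first.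
  by rewrite -grid_block ltr_grid mulSnr ltn_add2l ltn_neqAle ne.
apply: leq_trans kc _; apply: subset_leq_card; apply/fintype.subsetP => j.
by rewrite !inE => /andP[-> /ltW].
Qed.

Lemma stop_le_Xstat u c i : in_cells u c -> Xstat k i u < m.+1%:R^-1 ->
  (stop k c i)%:R <= Xstat k i u * (m.+1 * L.+1)%:R + 1.
Proof.
move=> uc Xm; set x := Xstat k i u in Xm *.
have /andP[x0 _] := Xstat_bounds k i u; rewrite -/x in x0.
have N0 : 0 < (m.+1 * L.+1)%:R :> R by rewrite ltr0n muln_gt0.
have y0 : 0 <= x * (m.+1 * L.+1)%:R by rewrite mulr_ge0 // ltW.
pose p := Num.truncn (x * (m.+1 * L.+1)%:R).
have /andP[p1 p2] : p%:R <= x * (m.+1 * L.+1)%:R < p.+1%:R.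
  exact: truncn_itv.
have pL : (p.+1 <= L.+1)%N.
  rewrite -(ltr_nat R) (le_lt_trans p1) // -ltr_pdivlMr //.
  by rewrite natrM invfM mulrCA divff ?mulr1 // pnatr_eq0.
rewrite (le_trans (_ : _ <= p.+1%:R)) //; last by rewrite -natr1 lerD2r.
rewrite ler_nat; apply: stop_le => //.
rewrite (block_count_grid _ uc) //.
have Zx : Zstat k i u = i%:R / m.+1%:R + x by rewrite /x /Xstat addrC subrK.
have Zlt : Zstat k i u < i.+1%:R / m.+1%:R.
  by rewrite Zx -[i.+1%:R]natr1 mulrDl mul1r ltrD2l.
have := lexx (Zstat k i u); rewrite {1}Zstat_le // => kc.
apply: leq_trans kc _; apply: subset_leq_card; apply/fintype.subsetP => j.
rewrite !inE => /andP[-> uz]; apply: le_lt_trans uz _.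
by rewrite Zx gridD grid_block ltrD2l /grid ltr_pdivlMr.
Qed.

Lemma sum_Xstat_le_finished u c (T : nat) : in_cells u c -> (T <= L.+1)%N ->
  finished k c T -> \sum_(i < m.+1) Xstat k i u <= grid T.
Proof.
move=> uc TL dT.
have stops (i : 'I_m.+1) : (stop k c i <= L.+1)%N.
  by apply: leq_trans TL; move: dT; rewrite /finished (bigD1 i) //=; lia.
apply: (@le_trans _ _ (\sum_(i < m.+1) grid (stop k c i))).
  by apply: ler_sum => i _; exact: Xstat_le_stop.
by rewrite -mulr_suml -natr_sum ler_pM2r ?invr_gt0 ?ltr0n ?muln_gt0 // ler_nat.
Qed.

(** Rounding each of the [m.+1] order statistics up to the grid costs one cell per
    interval, hence the term [m.+1%:R]. *)
Lemma finished_sum_Xstat u c (t : R) : in_cells u c -> t < m.+1%:R^-1 ->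
  \sum_(i < m.+1) Xstat k i u <= t ->
  finished k c (Num.truncn (t * (m.+1 * L.+1)%:R + m.+1%:R)).
Proof.
move=> uc tm St.
have X0 i : 0 <= Xstat k i u by have /andP[] := Xstat_bounds k i u.
have S0 : 0 <= \sum_(i < m.+1) Xstat k i u by exact: sumr_ge0.
have t0 : 0 <= t := le_trans S0 St.
have Xt i : Xstat k i u <= t.
  by apply: le_trans St; rewrite (bigD1 i) //= lerDl sumr_ge0.
rewrite /finished truncn_ge_nat ?addr_ge0 ?mulr_ge0 //.
rewrite natr_sum.
rewrite (le_trans (ler_sum _ (fun i _ => stop_le_Xstat uc (le_lt_trans (Xt i) tm)))) //.
rewrite big_split /= -mulr_suml sumr_const card_ord lerD2r.
by rewrite ler_pM2r // ltr0n muln_gt0.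
Qed.

End Grid.

(** * Uniform variables fall uniformly in the cells *)

Section CellProbability.
Variables (R : realType) (d : measure_display) (T : measurableType d).
Variables (P : probability T R) (n m L : nat) (U : 'I_n -> {RV P >-> R}).
Hypothesis hunif : forall j, uniform01 (U j).
Hypothesis hindep : mutually_independent U.
Local Notation C := ('I_m.+1 * 'I_L.+1)%type.
Local Notation N := (m.+1 * L.+1)%N.
Implicit Types (c : {ffun 'I_n -> C}).

Lemma uniform01_itv j (a b : R) : 0 <= a -> a <= b -> b <= 1 ->
  P (U j @^-1` `[a, b[) = (b - a)%:E.
Proof.
move=> a0 ab b1; transitivity (distribution P (U j) `[a, b[); first by [].
rewrite hunif; last exact: measurable_itv.
rewrite /uniform_prob integral_uniform_pdf setIidl; last first.
  by move=> x; rewrite /= !in_itv /= => /andP[ax xb];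
    rewrite (le_trans a0) //= ltW // (lt_le_trans xb).
transitivity (\int[lebesgue_measure]_(x in `[a, b[) (1%:E : \bar R))%E.
  apply: eq_integral => x; rewrite inE /= in_itv /= => /andP[ax xb].
  by rewrite /uniform_pdf (le_trans a0) //= ltW ?(lt_le_trans xb) // subr0 invr1.
rewrite integral_cst // mul1e.
transitivity (@lebesgue_measure R `[a, b[%classic); first by [].
rewrite lebesgue_measure_itv /= lte_fin.
case: ltP => // ba; congr EFin.
by apply/eqP; rewrite eq_sym subr_eq0 eq_le ab ba.
Qed.

Definition cells_event c : set T := [set w | in_cells (fun j => U j w) c].

Lemma cells_eventE c : cells_event c =
  \bigcap_(j in [set` [set: 'I_n]%SET]) 
    (U j @^-1` `[grid R m L (cell_index (c j)),
      grid R m L (cell_index (c j)).+1[).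
Proof.
apply/seteqP; split => w /=.
  by move=> /forallP H j _ /=; rewrite in_itv /=; exact: H.
move=> H; apply/forallP => j.
by have := H j (finset.in_setT j); rewrite /= in_itv.
Qed.

Lemma measurable_cells_event c : measurable (cells_event c).
Proof.
rewrite cells_eventE; apply: fin_bigcap_measurable => // j _.
by rewrite -[X in measurable X]setTI; exact: measurable_funP.
Qed.

(** Independence makes the configurations of the grid equiprobable. *)
Lemma prob_cells_event c : P (cells_event c) = ((N%:R^-1) ^+ n)%:E.
Proof.
rewrite cells_eventE hindep; last by move=> j _; exact: measurable_itv.
rewrite (eq_bigr (fun=> (N%:R^-1)%:E)) => [|j _].
  rewrite prodEFin; congr EFin; rewrite prodr_const; congr (_ ^+ _).
  by rewrite cardsT card_ord.
have N0 : 0 < N%:R :> R by rewrite ltr0n muln_gt0.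
have cN : (cell_index (c j) < N)%N.
  rewrite /cell_index; apply: (@leq_trans ((c j).1.+1 * L.+1)%N).
    by rewrite mulSnr ltn_add2l ltn_ord.
  by rewrite leq_mul2r ltn_ord orbT.
rewrite uniform01_itv.
- by rewrite /grid -mulrBl -natr1 addrAC subrr add0r mul1r.
- by rewrite divr_ge0 // ltW.
- by rewrite ler_grid.
- by rewrite /grid ler_pdivrMr // mul1r ler_nat.
Qed.

Lemma cells_event_inj w c c' : cells_event c w -> cells_event c' w -> c = c'.
Proof.
move=> wc wc'; apply/ffunP => j.
have e : cell_index (c j) = cell_index (c' j).
  move: wc wc' => /forallP /(_ j) /andP[h1 h2] /forallP /(_ j) /andP[h3 h4].
  have := le_lt_trans h1 h4; have := le_lt_trans h3 h2.
  by rewrite !ltr_grid; lia.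
move: e; rewrite /cell_index; case: (c j) (c' j) => [[x xm] [y yL]] [[x' xm'] [y' yL']] /= e.
have e1 : x = x'.
  by have := congr1 (fun z => z %/ L.+1)%N e; rewrite !divnMDl // !divn_small // !addn0.
have e2 : y = y' by move: e; rewrite e1 => /addnI.
by congr pair; apply: val_inj.
Qed.

Lemma prob_cells_union (D : {set {ffun 'I_n -> C}}) :
  P (\bigcup_(c in [set` D]) cells_event c) = (#|D|%:R / (N ^ n)%:R)%:E.
Proof.
rewrite measure_fin_bigcup //; last 2 first.
- by move=> c c' _ _ [w []]; exact: cells_event_inj.
- by move=> c _; exact: measurable_cells_event.
rewrite -(@bigfs _ _ _ _ (index_enum _) (mem D)) ?index_enum_uniq //; last first.
  by move=> c _; rewrite mem_index_enum.
rewrite (eq_bigr (fun=> ((N%:R^-1) ^+ n)%:E)) => [|c _]; last exact: prob_cells_event.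
rewrite sumEFin sumr_const -[X in X%:E = _]mulr_natl; congr EFin; congr (_ * _).
by rewrite natrX exprVn.
Qed.
End CellProbability.

(** * From counts of configurations to binomial tails *)

Section Counting.
Variable R : realType.

Lemma card_sum_binomial_tail (n q N t : nat) : (t <= N)%N -> (0 < N)%N ->
  (\sum_(A : {set 'I_n} | (q <= #|A|)%N) t ^ #|A| * (N - t) ^ (n - #|A|))%N%:R
    / (N ^ n)%:R = (binomial_tail R n q).[t%:R / N%:R].
Proof.
move=> tN N0.
have N0' : N%:R != 0 :> R by rewrite pnatr_eq0 -lt0n.
have An (A : {set 'I_n}) : (#|A| < n.+1)%N.
  by rewrite ltnS -[X in (_ <= X)%N](card_ord n) max_card.
rewrite (partition_big (fun A : {set 'I_n} => inord #|A| : 'I_n.+1)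
  (fun j : 'I_n.+1 => q <= j)%N) /=; last first.
  by move=> A; rewrite inordK.
rewrite /binomial_tail horner_sum natr_sum mulr_suml.
have powers i : (i <= n)%N -> ('C(n, i) * (t ^ i * (N - t) ^ (n - i)))%N%:R / (N ^ n)%:R =
    'C(n, i)%:R * ((t%:R / N%:R) ^+ i * (1 - t%:R / N%:R) ^+ (n - i)) :> R.
  move=> i_n; rewrite natrM -mulrA; congr (_ * _).
  have -> : 1 - t%:R / N%:R = (N%:R - t%:R) / N%:R :> R by rewrite mulrBl divff.
  rewrite -[in (N ^ n)%N](subnKC i_n) natrM !natrX natrB // exprD.
  by rewrite !expr_div_n mulf_div.
transitivity (\sum_(j < n.+1 | (q <= j)%N)
    ('C(n, j)%:R *: ('X^j * (1 - 'X) ^+ (n - j)) : {poly R}).[t%:R / N%:R]).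
  apply: eq_bigr => j qj.
  rewrite (eq_bigr (fun=> t ^ j * (N - t) ^ (n - j))%N); last first.
    by move=> A /andP[_ /eqP <-]; rewrite inordK.
  rewrite sum_nat_cond_const -(_ : 'C(n, j) = #|_|)%N; last first.
    have := card_draws 'I_n j; rewrite card_ord => <-; apply: eq_card => A.
    by rewrite !inE -val_eqE /= inordK //; case: eqP => [->|]; rewrite ?qj // andbF.
  have jn : (j <= n)%N by rewrite -ltnS.
  rewrite hornerZ hornerM hornerXn horner_exp hornerD hornerN hornerX hornerC.
  exact: powers.
rewrite -(big_mkord (fun j => q <= j)%N
  (fun j => ('C(n, j)%:R *: ('X^j * (1 - 'X) ^+ (n - j)) : {poly R}).[t%:R / N%:R])).
have [qn|qn] := leqP q n.+1.
  rewrite (big_cat_nat (n := q)) //= big_nat_cond big1 ?add0r; last first.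
    by move=> j /andP[/andP[_ jq] qj]; move: jq; rewrite ltnNge qj.
  by rewrite big_nat_cond [RHS]big_nat; apply: eq_bigl => j; case: (q <= j)%N; rewrite ?andbT.
rewrite [RHS]big_geq ?(ltnW qn) // big_nat_cond big1 // => j /andP[/andP[_ jn] qj].
by move: (leq_trans qn (leq_trans qj (ltnW jn))); rewrite ltnn.
Qed.
End Counting.

(** Used to bound from below the number of configurations without ties. *)
Lemma ffact_ge (N n j : nat) : (j <= n)%N -> ((N - n) ^ j <= N ^_ j)%N.
Proof.
elim: j => // j IH jn; rewrite expnSr ffactnSr leq_mul ?IH ?(ltnW jn) //.
by rewrite leq_sub2l // ltnW.
Qed.

(** * The law of the sum below the interval length *)

Section LawOfSum.
Variables (R : realType) (d : measure_display) (T : measurableType d).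
Variables (P : probability T R) (n m k : nat) (U : 'I_n -> {RV P >-> R}).
Hypothesis k_gt0 : (0 < k)%N.
Hypothesis hunif : forall j, uniform01 (U j).
Hypothesis hindep : mutually_independent U.

Definition sumX (w : T) : R := \sum_(i < m.+1) Xstat k i (fun j => U j w).

Lemma measurable_Zstat (i : 'I_m.+1) :
  measurable_fun [set: T] (fun w => Zstat k i (fun j => U j w)).
Proof.
apply: (measurability _ (RGenOInfty.measurableE R)) => //.
move=> _ [_ [z ->] <-]; rewrite setTI.
have [zi|zi] := ltP z (i.+1%:R / m.+1%:R); last first.
  rewrite (_ : _ @^-1` _ = set0) //; apply/seteqP; split => // w /=.
  have /andP[_ h] := Zstat_bounds k i (fun j => U j w).
  by rewrite in_itv /= andbT ltNge (le_trans h).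
pose B (w : T) : R := \sum_(j < n) ((i%:R / m.+1%:R <= U j w) && (U j w <= z))%:R.
have mB : measurable_fun [set: T] B.
  apply: measurable_sum => j.
  rewrite (_ : (fun w => _) = \1_(U j @^-1` `[i%:R / m.+1%:R, z])).
    apply: measurable_indic; rewrite -[X in measurable X]setTI.
    exact: measurable_funP.
  apply/funext => w; rewrite indicE; congr (nat_of_bool _)%:R.
  by apply/idP/idP; rewrite inE /= in_itv.
have eB w : B w = #|[pred j | (i%:R / m.+1%:R <= U j w) && (U j w <= z)]|%:R.
  rewrite /B -natr_sum; congr _%:R; rewrite -sum1_card [RHS]big_mkcond /=.
  by apply: eq_bigr => j _; rewrite inE; case: ifP.
rewrite (_ : _ @^-1` _ = B @^-1` `]-oo, k%:R[).
  by rewrite -[X in measurable X]setTI; exact: mB.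
have zE w : (z < Zstat k i (fun j => U j w)) = (B w < k%:R).
  by rewrite ltNge Zstat_le // eB ltr_nat ltnNge.
by apply/seteqP; split => w /=; rewrite !in_itv /= andbT zE.
Qed.

Lemma measurable_sumX : measurable_fun [set: T] sumX.
Proof.
apply: measurable_sum => i; apply: measurable_funB => //.
exact: measurable_Zstat.
Qed.

Lemma sumX_ge0 w : 0 <= sumX w.
Proof. by apply: sumr_ge0 => i _; have /andP[] := Xstat_bounds k i (fun j => U j w). Qed.

Let sumX_le_event (t : R) : set T := [set w | sumX w <= t].

Lemma measurable_sumX_le t : measurable (sumX_le_event t).
Proof.
rewrite (_ : sumX_le_event t = [set: T] `&` sumX @^-1` `]-oo, t]).
  exact: measurable_sumX.
by rewrite setTI; apply/seteqP; split => w /=; rewrite in_itv.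
Qed.

(** The configurations in cells cover an event of probability 1, and each outcome
    with [sumX w <= t] has a finished configuration. *)
Lemma prob_sumX_upper (L : nat) (t : R) : 0 <= t < m.+1%:R^-1 ->
  let N := (m.+1 * L.+1)%N in let T' := Num.truncn (t * N%:R + m.+1%:R) in
  (T' <= L.+1)%N ->
  (P [set w | (sumX w <= t)%R] <= ((binomial_tail R n (k * m.+1)).[T'%:R / N%:R])%:E)%E.
Proof.
move=> /andP[t0 tm] N T' T'L.
have N0 : (0 < N)%N by rewrite muln_gt0.
pose D : {set {ffun 'I_n -> 'I_m.+1 * 'I_L.+1}} := [set c | finished k c T']%SET.
pose full := \bigcup_(c in [set` [set: {ffun 'I_n -> 'I_m.+1 * 'I_L.+1}]%SET]) cells_event U c.
have mU (E : {set {ffun 'I_n -> 'I_m.+1 * 'I_L.+1}}) :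
  measurable (\bigcup_(c in [set` E]) cells_event U c).
  by apply: fin_bigcup_measurable => // c _; exact: measurable_cells_event.
have full1 : P full = 1%E.
  by rewrite prob_cells_union // cardsT card_ffun card_prod !card_ord divff //.
have full0 : P (~` full) = 0%E.
  by rewrite probability_setC ?full1 ?subee //; exact: mU.
have sub : sumX_le_event t `<=` (\bigcup_(c in [set` D]) cells_event U c) `|` ~` full.
  move=> w Sw; have [[c _ wc]|nf] := pselect (full w); last by right.
  by left; exists c => //=; rewrite inE; exact: (finished_sum_Xstat k_gt0 wc tm Sw).
apply: (@le_trans _ _ (P ((\bigcup_(c in [set` D]) cells_event U c) `|` ~` full))).
  apply: le_measure => //; rewrite inE; first exact: measurable_sumX_le.
  by apply: measurableU => //; apply: measurableC; exact: mU.
apply: (@le_trans _ _ (P (\bigcup_(c in [set` D]) cells_event U c) + P (~` full))%E).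
  by apply: measureU2 => //; apply: measurableC; exact: mU.
rewrite full0 adde0 prob_cells_union //.
rewrite lee_fin -card_sum_binomial_tail //; last first.
  by rewrite (leq_trans T'L) // leq_pmull.
rewrite ler_pM2r ?invr_gt0 ?ltr0n ?expn_gt0 ?N0 // ler_nat.
have := card_found 'I_n m k_gt0 T'L; rewrite card_ord => <-.
apply/subset_leq_card/fintype.subsetP => c; rewrite !inE.
exact: finished_found.
Qed.

(** The correction bounds the probability that two values share a cell, in which case
    finding enough labels does not guarantee that all blocks are complete. *)
Lemma prob_sumX_lower (L : nat) (t : R) : 0 <= t < m.+1%:R^-1 ->
  let N := (m.+1 * L.+1)%N in let T' := Num.truncn (t * N%:R) in
  (n <= N)%N -> (T' <= L.+1)%N ->
  (((binomial_tail R n (k * m.+1)).[T'%:R / N%:R] - 1 + (1 - n%:R / N%:R) ^+ n)%:E <=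
   P [set w | (sumX w <= t)%R])%E.
Proof.
move=> /andP[t0 tm] N T' nN T'L.
have N0 : (0 < N)%N by rewrite muln_gt0.
have N0' : 0 < N%:R :> R by rewrite ltr0n.
pose D : {set {ffun 'I_n -> 'I_m.+1 * 'I_L.+1}} := [set c | finished k c T']%SET.
have sub : \bigcup_(c in [set` D]) cells_event U c `<=` sumX_le_event t.
  move=> w [c /=]; rewrite inE => dc wc.
  apply: le_trans (sum_Xstat_le_finished k_gt0 wc T'L dc) _.
  rewrite /grid ler_pdivrMr //.
  by have /andP[] := truncn_itv (mulr_ge0 t0 (ltW N0')).
apply: (@le_trans _ _ (P (\bigcup_(c in [set` D]) cells_event U c))); last first.
  apply: le_measure => //; rewrite inE; last exact: measurable_sumX_le.
  by apply: fin_bigcup_measurable => // c _; exact: measurable_cells_event.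
rewrite prob_cells_union // lee_fin -card_sum_binomial_tail //; last first.
  by rewrite (leq_trans T'L) // leq_pmull.
have := card_found 'I_n m k_gt0 T'L; rewrite card_ord => <-.
set F := finset _.
pose J : {set {ffun 'I_n -> 'I_m.+1 * 'I_L.+1}} :=
  [set c : {ffun 'I_n -> 'I_m.+1 * 'I_L.+1} | injectiveb c]%SET.
have cJ : #|J| = (N ^_ n)%N by rewrite card_inj_ffuns card_prod !card_ord.
have cFJ : (#|F| + #|J| <= #|D| + N ^ n)%N.
  rewrite -cardsUI addnC leq_add //.
    apply/subset_leq_card/fintype.subsetP => c; rewrite !inE => /andP[fc /injectiveP ci].
    exact: found_finished.
  by rewrite (leq_trans (max_card _)) // card_ffun card_prod !card_ord.
have Nn0 : 0 < (N ^ n)%:R :> R by rewrite ltr0n expn_gt0 N0.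
have e : (1 - n%:R / N%:R) ^+ n = ((N - n) ^ n)%:R / (N ^ n)%:R :> R.
  rewrite !natrX natrB // -expr_div_n mulrBl divff //.
  by rewrite pnatr_eq0 -lt0n.
rewrite e -(ler_pM2r Nn0) 2!mulrDl mulN1r !divfK ?gt_eqF //.
rewrite addrAC lerBlDr -!natrD ler_nat (leq_trans _ cFJ) // leq_add2l cJ.
exact: ffact_ge.
Qed.


(** As the mesh tends to 0, the success probabilities of the two bounds tend to [t]
    and the correction for ties vanishes. *)
Lemma prob_sumX_le (t : R) : 0 <= t < m.+1%:R^-1 ->
  P [set w | (sumX w <= t)%R] = ((binomial_tail R n (k * m.+1)).[t])%:E.
Proof.
move=> t01; have /andP[t0 tm] := t01.
set p := binomial_tail _ _ _; set F := P _.
have Ffin : F \is a fin_num by apply: fin_num_measure; exact: measurable_sumX_le.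
rewrite -(fineK Ffin); congr EFin.
pose N (L : nat) := (m.+1 * L.+1)%N.
have N0 L : 0 < (N L)%:R :> R by rewrite ltr0n muln_gt0.
have mN L : m.+1%:R / (N L)%:R = harmonic L :> R.
  by rewrite /harmonic /N natrM invfM mulrA divff ?mul1r // pnatr_eq0.
have leN (c : R) L : 0 <= c -> c / (N L)%:R <= c * harmonic L.
  move=> c0; rewrite ler_wpM2l // lef_pV2 ?posrE ?ltr0n // ler_nat.
  by rewrite /N leq_pmull.
pose up L : R := (Num.truncn (t * (N L)%:R + m.+1%:R))%:R / (N L)%:R.
pose lo L : R := (Num.truncn (t * (N L)%:R))%:R / (N L)%:R.
have tN0 L : 0 <= t * (N L)%:R by rewrite mulr_ge0 // ltW.
have up_t : up L @[L --> \oo] --> t.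
  apply: (@squeeze_cvgr _ _ _ R (fun=> t) (fun L => t + harmonic L) up); last 2 first.
  - exact: cvg_cst.
  - by rewrite -[X in _ --> X]addr0; apply: cvgD; [exact: cvg_cst|exact: cvg_harmonic].
  near=> L; rewrite /up; have x0 := addr_ge0 (tN0 L) (ler0n R m.+1).
  have /andP[h1 h2] := truncn_itv x0; apply/andP; split.
    rewrite ler_pdivlMr //; move: h2; rewrite -!natr1 addrA ltrD2r => /ltW h2.
    by apply: le_trans h2; rewrite lerDl.
  by rewrite ler_pdivrMr // mulrDl -mN divfK // gt_eqF.
have lo_t : lo L @[L --> \oo] --> t.
  apply: (@squeeze_cvgr _ _ _ R (fun L => t - harmonic L) (fun=> t) lo); last 2 first.
  - by rewrite -[X in _ --> X]subr0; apply: cvgB; [exact: cvg_cst|exact: cvg_harmonic].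
  - exact: cvg_cst.
  near=> L; rewrite /lo; have /andP[h1 h2] := truncn_itv (tN0 L); apply/andP; split.
    rewrite lerBlDr; apply: (@le_trans _ _ (lo L + 1 / (N L)%:R)).
      by rewrite /lo -mulrDl natr1 ler_pdivlMr // ltW.
    by rewrite lerD2l -[leRHS]mul1r leN.
  by rewrite ler_pdivrMr.
have T'L : \forall L \near \oo, (Num.truncn (t * (N L)%:R + m.+1%:R) <= L.+1)%N.
  have : harmonic L @[L --> \oo] --> (0 : R) by exact: cvg_harmonic.
  move=> /cvgr_lt /(_ (m.+1%:R^-1 - t)); rewrite subr_gt0 => /(_ tm).
  apply: filterS => L hL; rewrite -(ler_nat R).
  have /andP[h1 _] := truncn_itv (addr_ge0 (tN0 L) (ler0n R m.+1)).
  apply: le_trans h1 _; rewrite -(ler_pM2r (_ : 0 < (N L)%:R^-1)) ?invr_gt0 //.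
  rewrite mulrDl mulfK ?gt_eqF // mN.
  have -> : L.+1%:R / (N L)%:R = m.+1%:R^-1 :> R.
    by rewrite /N natrM invfM mulrCA divff ?mulr1 // pnatr_eq0.
  by rewrite -lerBrDl ltW.
have cp : continuous (horner p) by exact: continuous_horner.
apply/eqP; rewrite eq_le; apply/andP; split.
  have : p.[up L] @[L --> \oo] --> p.[t] by apply: continuous_cvg => //; exact: cp.
  move=> pu; apply: (cvgr_to_ge pu).
  near=> L; rewrite -lee_fin fineK //; apply: prob_sumX_upper => //.
  by near: L.
have lim1 : (p.[lo L] - 1 + (1 - n%:R / (N L)%:R) ^+ n) @[L --> \oo] --> p.[t].
  rewrite -[X in _ --> X](subrK 1) -[X in _ --> _ + X](expr1n _ n).
  apply: cvgD.
    apply: cvgB; last exact: cvg_cst.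
    by apply: continuous_cvg => //; exact: cp.
  apply: (@continuous_cvg _ _ _ _ _ _ (fun x : R => x ^+ n)); first exact: exprn_continuous.
  apply: (@squeeze_cvgr _ _ _ R (fun L => 1 - n%:R * harmonic L) (fun=> 1)); last 2 first.
  - rewrite -[X in _ --> X]subr0 -[X in _ --> _ - X](mulr0 n%:R).
    apply: cvgB; first exact: cvg_cst.
    by apply: cvgM; [exact: cvg_cst|exact: cvg_harmonic].
  - exact: cvg_cst.
  near=> L; rewrite lerD2l lerN2 leN //= lerBlDr lerDl divr_ge0 //.
apply: (cvgr_to_le lim1).
near=> L; rewrite -lee_fin fineK //; apply: prob_sumX_lower => //.
- near: L; exists n => // L /= nL.
  by rewrite (leq_trans nL) // (leq_trans (leqnSn _)) // leq_pmull.
- have h : (Num.truncn (t * (N L)%:R + m.+1%:R) <= L.+1)%N by near: L.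
  by apply: leq_trans h; apply: le_truncn; rewrite lerDl.
Unshelve. all: by end_near.
Qed.

End LawOfSum.

(** * Expectations of variables whose laws agree below a threshold *)

Section Transfer.
Variables (R : realType) (d : measure_display) (T : measurableType d).
Variables (P : probability T R) (S : T -> R) (c : R).
Hypothesis mS : measurable_fun [set: T] S.
Variable B : probability (measurableTypeR R) R.
Hypothesis tailE : forall t : R, t < c -> P [set w | t < S w] = B `]t, +oo[%classic.

(** Truncating both variables at [c] makes their laws equal everywhere, and does not
    affect a function that vanishes from [c] on. *)
Lemma integral_law_below (f : R -> \bar R) :
  measurable_fun [set: R] f -> (forall x, 0 <= f x)%E ->
  (forall x, (c <= x)%R -> f x = 0)%E ->
  (\int[P]_w f (S w) = \int[B]_x f x)%E.
Proof.
move=> mf f0 fc.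
pose Y (w : T) : measurableTypeR R := Num.min (S w) c.
pose Z (x : measurableTypeR R) : measurableTypeR R := Num.min x c.
have mY : measurable_fun [set: T] Y by exact: measurable_minr.
have mZ : measurable_fun [set: measurableTypeR R] Z by apply: measurable_minr.
have fmin x : f (Num.min x c) = f x.
  by case: (leP x c) => // cx; rewrite !fc // ltW.
pose YM : {mfun T >-> measurableTypeR R} := HB.pack Y (isMeasurableFun.Build _ _ _ _ Y mY).
pose ZM : {mfun measurableTypeR R >-> measurableTypeR R} :=
  HB.pack Z (isMeasurableFun.Build _ _ _ _ Z mZ).
transitivity (\int[distribution P YM]_y f y)%E.
  rewrite ge0_integral_distribution //.
  by apply: eq_integral => w _; rewrite /= /Y fmin.
transitivity (\int[distribution B ZM]_y f y)%E; last first.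
  rewrite ge0_integral_distribution //.
  by apply: eq_integral => x _; rewrite /= /Z fmin.
apply: eq_measure_integral => A mA _.
apply: (@measure_unique _ R (measurableTypeR R) (@RGenOInfty.G R)
  (fun k => `]- k%:R, +oo[%classic)).
- exact: RGenOInfty.measurableE.
- move=> _ _ [x ->] [y ->]; exists (Num.max x y).
  by apply/seteqP; split => z /=; rewrite !in_itv /= !andbT gt_max => /andP.
- by move=> k; exists (- k%:R).
- apply/seteqP; split => // x _; exists (Num.truncn `|x|).+1 => //=.
  rewrite in_itv /= andbT ltrNl (le_lt_trans _ (truncnS_gt _)) //.
  by rewrite -normrN ler_norm.
- move=> _ [t ->]; have [tc|ct] := ltP t c.
    transitivity (P [set w | t < S w]).
      congr (P _); apply/seteqP.
      by split => w /=; rewrite /Y in_itv /= andbT lt_min tc andbT.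
    rewrite tailE //; congr (B _); apply/seteqP.
    by split => w /=; rewrite /Z !in_itv /= !andbT lt_min tc andbT.
  transitivity (P set0).
    congr (P _); apply/seteqP; split => w //=.
    by rewrite /Y in_itv /= andbT lt_min andbC ltNge ct.
  rewrite measure0 -(measure0 B); congr (B _); apply/seteqP; split => w //=.
  by rewrite /Z in_itv /= andbT lt_min andbC ltNge ct.
- by move=> k; rewrite (le_lt_trans (probability_le1 _ _)) ?ltry.
- exact: mA.
Qed.

Lemma prob_law_below : P [set w | c <= S w] = B `[c, +oo[%classic.
Proof.
pose f (x : R) : \bar R := (\1_(`]-oo, c[%classic) x)%:E.
have e : (\int[P]_w f (S w) = \int[B]_x f x)%E.
  apply: integral_law_below.
  - by apply/measurable_EFinP/measurable_indic.
  - by move=> x; rewrite lee_fin.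
  - by move=> x cx; rewrite /f indicE mem_setE in_itv /= ltNge cx.
have mc : measurable [set w | S w < c].
  rewrite (_ : [set w | _] = [set: T] `&` S @^-1` `]-oo, c[); first exact: mS.
  by rewrite setTI; apply/seteqP; split => w /=; rewrite in_itv.
have e1 : (\int[B]_x f x = B `]-oo, c[%classic)%E.
  by rewrite integral_indic // setIT.
have e2 : (\int[P]_w f (S w) = P [set w | (S w < c)%R])%E.
  transitivity (\int[P]_w (\1_[set w | (S w < c)%R] w)%:E)%E.
    apply: eq_integral => w _; rewrite /f !indicE.
    suff -> : (S w \in `]-oo, c[%classic) = (w \in [set w | S w < c]) by [].
    by apply/idP/idP; rewrite !inE /= ?in_itv.
  by rewrite integral_indic // setIT.
move: e; rewrite e1 e2 => e.
have -> : [set w | c <= S w] = ~` [set w | S w < c].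
  by apply/seteqP; split => w /=; rewrite leNgt => /negP.
have -> : `[c, +oo[%classic = ~` `]-oo, c[%classic by rewrite setCitvl.
by rewrite !probability_setC // e.
Qed.

Variables (h : R -> R) (M : R).
Hypotheses (mh : measurable_fun [set: R] h) (h0 : forall x, 0 <= h x).
Hypothesis hM : forall x, c <= x -> h x <= M.

(** Stated for an arbitrary variable, so that it applies both to [S] under [P] and to
    the identity under [B]. *)
Lemma integral_split (d' : measure_display) (T' : measurableType d')
    (Q : probability T' R) (V : T' -> R) (mV : measurable_fun [set: T'] V) :
  exists2 e : R, 0 <= e <= M * fine (Q [set w | c <= V w]) &
    (\int[Q]_w (h (V w))%:E =
      \int[Q]_w (h (V w) * \1_(`]-oo, c[%classic) (V w))%:E + e%:E)%E.
Proof.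
have mC : measurable [set w | c <= V w].
  rewrite (_ : [set w | _] = [set: T'] `&` V @^-1` `[c, +oo[); first exact: mV.
  by rewrite setTI; apply/seteqP; split => w /=; rewrite in_itv /= andbT.
have M0 : 0 <= M by apply: le_trans (h0 c) (hM (lexx c)).
have mhV D : measurable_fun D (fun w => (h (V w))%:E).
  by apply/measurable_funTS/measurable_EFinP/measurableT_comp.
pose I2 := (\int[Q]_(w in [set w | (c <= V w)%R]) (h (V w))%:E)%E.
have I20 : (0 <= I2)%E by apply: integral_ge0 => w _; rewrite lee_fin.
have I2M : (I2 <= M%:E * Q [set w | (c <= V w)%R])%E.
  rewrite -integral_cst //; apply: ge0_le_integral => //.
  - by move=> w _; rewrite lee_fin.
  - by move=> w cw; rewrite lee_fin hM.
have Qfin : Q [set w | (c <= V w)%R] \is a fin_num by exact: fin_num_measure.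
have I2fin : I2 \is a fin_num.
  by rewrite ge0_fin_numE // (le_lt_trans I2M) // -(fineK Qfin) -EFinM ltry.
exists (fine I2).
  rewrite fine_ge0 //= -lee_fin fineK // EFinM fineK //.
rewrite fineK // -[X in integral _ X _ = _](setvU [set w | c <= V w]).
rewrite ge0_integral_setU //.
- congr (_ + _)%E; rewrite [LHS]integral_mkcond; apply: eq_integral => w _.
  rewrite patchE indicE mem_setE in_itv /=.
  case: ifPn => [|]; first by rewrite inE /= => /negP; rewrite -ltNge => ->; rewrite mulr1.
  by rewrite notin_setE /= => /contrapT cV; rewrite ltNge cV mulr0.
- exact: measurableC.
- by move=> w _; rewrite lee_fin.
- by apply/disj_set2P; rewrite setICl.
Qed.

Lemma integral_law_cut :
  (\int[P]_w (h (S w) * \1_(`]-oo, c[%classic) (S w))%:E =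
   \int[B]_x (h x * \1_(`]-oo, c[%classic) x)%:E)%E.
Proof.
apply: (integral_law_below (f := fun x => (h x * \1_(`]-oo, c[%classic) x)%:E)).
- by apply/measurable_EFinP/measurable_funM => //; exact: measurable_indic.
- by move=> x; rewrite lee_fin mulr_ge0.
- by move=> x cx; rewrite indicE mem_setE in_itv /= ltNge cx mulr0.
Qed.

(** The parts below [c] coincide, and the parts above [c] both lie between 0 and [M]
    times the same mass. *)
Lemma integral_law_close (V : R) :
  (\int[B]_x (h x)%:E = V%:E)%E ->
  exists2 E : R, (\int[P]_w (h (S w))%:E = E%:E)%E &
    `|E - V| <= M * fine (B `[c, +oo[%classic).
Proof.
move=> hV; have [e1 e1M eP] := integral_split P mS.
have [e2 e2M eB] := integral_split B (@measurable_id _ _ [set: R]).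
move: eB e2M e1M; rewrite hV prob_law_below.
rewrite (_ : [set w | c <= w] = `[c, +oo[%classic); last first.
  by apply/seteqP; split => x /=; rewrite in_itv /= andbT.
move: eP; rewrite integral_law_cut; set I := (\int[B]_x _)%E.
case: I => [r| |] //= -> [e] e2M e1M.
exists (r + e1); first by [].
rewrite e opprD addrACA subrr add0r ler_norml.
move: e1M e2M; set b := M * _ => /andP[? ?] /andP[? ?].
by apply/andP; split; lra.
Qed.

Lemma integral_law_pinfty :
  (\int[B]_(x in `]-oo, c[) (h x)%:E = +oo)%E ->
  (\int[P]_w (h (S w))%:E = +oo)%E.
Proof.
move=> hoo; have [e1 _ ->] := integral_split P mS.
rewrite integral_law_cut (_ : integral _ _ _ = +oo%E) //.
rewrite -hoo [RHS]integral_mkcond; apply: eq_integral => x _.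
rewrite patchE indicE; by case: ifPn => _; rewrite ?mulr1 ?mulr0.
Qed.
End Transfer.

(** * The mean square error *)

Section MeanSquareError.
Variables (R : realType) (d : measure_display) (T : measurableType d).
Variables (P : probability T R) (n m k a b : nat) (U : 'I_n -> {RV P >-> R}).
Hypothesis kmE : (k * m.+1 = a.+1)%N.
Hypothesis nE : n = (a + b).+1.
Hypothesis hunif : forall j, uniform01 (U j).
Hypothesis hindep : mutually_independent U.

Let k_gt0 : (0 < k)%N.
Proof. by case: k kmE. Qed.

(** Below the interval length the sum follows the beta law; negative [t] are trivial as
    both laws live on the nonnegative reals. *)
Lemma prob_sumX_gt (t : R) : t < m.+1%:R^-1 ->
  P [set w | t < sumX m k U w] = beta_prob a.+1 b.+1 `]t, +oo[%classic.
Proof.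
move=> tm; have [t0|t0] := ltP t 0.
  rewrite (_ : [set w | _] = setT); last first.
    by apply/seteqP; split => // w _ /=; rewrite (lt_le_trans t0) // sumX_ge0.
  rewrite probability_setT; apply/esym/eqP; rewrite eq_le probability_le1 //=.
  rewrite -(@beta_prob01 R a.+1 b.+1); apply: le_measure; rewrite ?inE //.
  by move=> x; rewrite /= !in_itv /= andbT => /andP[x0 _]; exact: lt_le_trans x0.
have t01 : 0 <= t < m.+1%:R^-1 by rewrite t0.
have t1 : 0 <= t <= 1.
  by rewrite t0 ltW // (lt_le_trans tm) // invf_le1 // ler1n.
have -> : [set w | t < sumX m k U w] = ~` [set w | sumX m k U w <= t].
  by apply/seteqP; split => w /=; rewrite ltNge => /negP.
have -> : `]t, +oo[%classic = ~` `]-oo, t]%classic by rewrite setCitvl.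
rewrite !probability_setC //; last exact: measurable_sumX_le.
congr (_ - _)%E; apply: etrans (esym (beta_prob_ray a b t1)).
by rewrite (prob_sumX_le k_gt0 hunif hindep t01) kmE nE.
Qed.

End MeanSquareError.

Section MeanSquareErrorBounds.
Variables (R : realType) (d : measure_display) (T : measurableType d).
Variables (P : probability T R) (n m k : nat) (U : 'I_n -> {RV P >-> R}).
Hypothesis hunif : forall j, uniform01 (U j).
Hypothesis hindep : mutually_independent U.

Lemma sq_err_le (u v c x : R) : 0 <= u -> 0 <= v -> 0 < c -> c <= x ->
  (u / x - v) ^+ 2 <= (u / c + v) ^+ 2.
Proof.
move=> u0 v0 c0 cx; have x0 := lt_le_trans c0 cx.
have y1 : u / x <= u / c by rewrite ler_wpM2l // lef_pV2.
have y0 : 0 <= u / x by rewrite divr_ge0 // ltW.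
have z0 : 0 <= u / c := le_trans y0 y1.
rewrite -real_normK ?num_real // ler_sqr ?nnegrE ?addr_ge0 //.
by rewrite ler_norml; apply/andP; split; lra.
Qed.

(** The error term collects the discrepancy above the interval length, where the squared
    error is of order [n%:R ^+ 2] and the mass of order [n%:R^-1], and the lower order
    term of the exact beta expectation. *)
Lemma mse_close (q : nat) : (k * m.+1 = q.+3)%N -> (q.+3 <= n)%N ->
  exists2 E : R,
    (\int[P]_w (((q.+2%:R / sumX m k U w - n%:R) ^+ 2)%R)%:E = E%:E)%E &
    `|E - n%:R ^+ 2 / q.+1%:R| <=
     ((q.+2%:R * m.+1%:R + 1) ^+ 2 * m.+1%:R * q.+3%:R + q.+2%:R / q.+1%:R) * n%:R.
Proof.
move=> kmE qn; pose b := (n - q.+3)%N.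
have nE : n = (q.+2 + b).+1 by rewrite /b; lia.
pose h (x : R) := (q.+2%:R / x - n%:R) ^+ 2.
pose c : R := m.+1%:R^-1.
pose M : R := (q.+2%:R / c + n%:R) ^+ 2.
have c0 : 0 < c by rewrite invr_gt0.
have hM x : c <= x -> h x <= M by exact: sq_err_le.
have N3 : n%:R = (q + b).+3%:R :> R by rewrite nE.
have hV := beta_sq_err R q b; rewrite /= -N3 in hV.
have k0 : (0 < k)%N by case: k kmE.
have mS : measurable_fun [set: T] (sumX m k U) by exact: measurable_sumX.
have [E eE EV] := integral_law_close mS (prob_sumX_gt kmE nE hunif hindep)
   (measurable_sq_err q.+2%:R n%:R) (fun x => sqr_ge0 _) hM hV.
exists E; first exact: eE.
have n1 : 1 <= n%:R :> R by rewrite ler1n nE.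
have Mn : M <= (q.+2%:R * m.+1%:R + 1) ^+ 2 * n%:R ^+ 2.
  have A0 : 0 <= q.+2%:R * m.+1%:R :> R by rewrite mulr_ge0.
  rewrite /M /c invrK -exprMn; apply: lerXn2r; rewrite ?nnegrE.
  - exact: addr_ge0.
  - by rewrite mulr_ge0 // addr_ge0.
  by rewrite [leRHS]mulrDl mul1r lerD2r ler_peMr.
set p := fine _ in EV; have pfin : beta_prob q.+3 b.+1 `[c, +oo[%classic \is a fin_num.
  exact: fin_num_measure.
have pn : p * n%:R <= m.+1%:R * q.+3%:R.
  have := beta_tail_le q.+2 b c0; rewrite -(fineK pfin) -EFinM lee_fin -/p => H.
  have p0 : 0 <= p by rewrite fine_ge0.
  rewrite -ler_pdivrMl // -/c mulrA -ler_pdivlMr ?(lt_le_trans ltr01) //.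
  apply: le_trans H _; rewrite ler_wpM2l // lef_pV2 ?posrE ?ltr0n // ?(lt_le_trans ltr01) //.
    by rewrite nE ler_nat leqnSn.
  by rewrite nE.
have p0 : 0 <= p by rewrite fine_ge0.
have q0 : q.+1%:R != 0 :> R by rewrite pnatr_eq0.
have -> : E - n%:R ^+ 2 / q.+1%:R =
    E - (n%:R ^+ 2 - q.+2%:R * n%:R) / q.+1%:R - q.+2%:R * n%:R / q.+1%:R.
  by move: (E) (n%:R : R) (q.+2%:R : R) (q.+1%:R : R) q0 => *; field.
rewrite (le_trans (ler_normB _ _)) // [leRHS]mulrDl lerD //; last first.
  by rewrite ger0_norm ?divr_ge0 ?mulr_ge0 // mulrAC.
apply: le_trans EV _; apply: (@le_trans _ _ ((q.+2%:R * m.+1%:R + 1) ^+ 2 * n%:R ^+ 2 * p)).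
  by rewrite ler_wpM2r.
have := ler_wpM2l (sqr_ge0 (q.+2%:R * m.+1%:R + 1)) (ler_wpM2l (ler0n R n) pn).
by congr (is_true (_ <= _)); ring.
Qed.

Lemma mse_pinfty : (k * m.+1 = 2)%N -> m = 0%N -> (2 <= n)%N ->
  (\int[P]_w (((1 / sumX m k U w - n%:R) ^+ 2)%R)%:E = +oo)%E.
Proof.
move=> kmE m0 n2; pose b := (n - 2)%N.
have nE : n = (1 + b).+1 by rewrite /b; lia.
have k0 : (0 < k)%N by case: k kmE.
have mS : measurable_fun [set: T] (sumX m k U) by exact: measurable_sumX.
pose h (x : R) := (1 / x - n%:R) ^+ 2.
have c0 : 0 < m.+1%:R^-1 :> R by rewrite invr_gt0.
have hM x : m.+1%:R^-1 <= x -> h x <= (1 / m.+1%:R^-1 + n%:R) ^+ 2.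
  exact: sq_err_le.
apply: (integral_law_pinfty mS (prob_sumX_gt kmE nE hunif hindep)
   (measurable_sq_err 1 n%:R) (fun x => sqr_ge0 _) hM).
by rewrite m0 invr1; exact: beta_sq_err_pinfty.
Qed.
End MeanSquareErrorBounds.

(* For each number theta of distinct elements, [U theta] is a family of theta
   i.i.d. uniform variables on a probability space that may depend on theta.
   When k * m = 2 the division below is the one of [\bar R], so that the
   leading term is +oo, as is the expectation. *)
Theorem corollary2p3 (R : realType) (k m : nat) (hk : (2 <= k)%N)
    (hm : (1 <= m)%N)
    (d : nat -> measure_display)
    (T : forall theta : nat, measurableType (d theta))
    (P : forall theta : nat, probability (T theta) R)
    (U : forall theta : nat, 'I_theta -> {RV (P theta) >-> R})
    (hunif : forall (theta : nat) (j : 'I_theta), uniform01 (U theta j))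
    (hindep : forall theta : nat, mutually_independent (U theta)) :
  exists r : nat -> R,
    (r =o_\oo (fun theta : nat => theta%:R ^+ 2 : R)) /\
    \forall theta \near \oo,
      ('E_(P theta)[fun w =>
          ((xi_hat k (fun i : 'I_m => Xstat k i (fun j => U theta j w))
             - theta%:R) ^+ 2)%R]
       = (theta%:R ^+ 2)%R%:E / ((k * m)%:R - 2)%R%:E + (r theta)%:E)%E.
Proof.
case: m hm => // m _.
have [n kmE] : exists n, (k * m.+1)%N = n.+2 by exists (k * m.+1).-2; nia.
case: n kmE => [|q] kmE.
  (* k * m = 2: the leading term is divided by 0 in the extended reals, hence infinite. *)
  exists (fun=> 0); split.
    by apply/eqoP => e e0; near=> t; rewrite normr0 mulr_ge0 // ltW.
  exists 2%N => // t /= t2; rewrite unlock /xi_hat kmE.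
  have -> : (2%:R - 1 : R) = 1 by rewrite -[2%:R]natr1 addrK.
  rewrite subrr /inve eqxx gt0_muley ?adde0; last first.
    by rewrite lte_fin exprn_gt0 // ltr0n (leq_trans _ t2).
  have m0 : m = 0%N by nia.
  exact: (mse_pinfty (hunif t) (hindep t) kmE m0 t2).
pose E t : R := fine (\int[P t]_w (((q.+2%:R / sumX m k (U t) w - t%:R) ^+ 2)%R)%:E)%E.
pose r t : R := E t - t%:R ^+ 2 / q.+1%:R.
pose K : R := (q.+2%:R * m.+1%:R + 1) ^+ 2 * m.+1%:R * q.+3%:R + q.+2%:R / q.+1%:R.
have K0 : 0 <= K by rewrite addr_ge0 ?divr_ge0 // !mulr_ge0 ?sqr_ge0.
have Eprop t : (q.+3 <= t)%N ->
    (\int[P t]_w (((q.+2%:R / sumX m k (U t) w - t%:R) ^+ 2)%R)%:E = (E t)%:E)%E /\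
    `|r t| <= K * t%:R.
  move=> qt; have [e eE ek] := mse_close (hunif t) (hindep t) kmE qt.
  by rewrite /r /E eE.
exists r; split.
  apply/eqoP => e e0; near=> t.
  have qt : (q.+3 <= t)%N by near: t; exists q.+3.
  apply: le_trans (Eprop t qt).2 _.
  rewrite ger0_norm ?sqr_ge0 // expr2 mulrA ler_wpM2r // mulrC -ler_pdivrMr //.
  by near: t; exact: nbhs_infty_ger.
exists q.+3 => // t /= qt; rewrite unlock /xi_hat kmE.
have -> : (q.+3%:R - 1 : R) = q.+2%:R by rewrite -natr1 addrK.
have -> : (q.+3%:R - 2 : R) = q.+1%:R by rewrite -addn2 natrD addrK.
rewrite (Eprop t qt).1 /inve pnatr_eq0 /= -EFinM -EFinD; congr EFin.
by rewrite /r addrC subrK.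
Unshelve. all: by end_near.
Qed.
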